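(* Let $(\mathbf X,d)$ be a dissimilarity space, let $\mathcal U$ be a cover of $\mathbf X$, and let $R_1\le R_2\le R_3$ be the associated thresholds (defined in the context). Then $H_k(\mathcal R(\mathbf X,\mathcal U;r))$ and $H_k(\mathcal R(\mathbf X;r))$ are $(\mathrm{id},\alpha)$-interleaved, where $\alpha$ is a non-decreasing map with $\alpha(r)=r$ for $r\le R_1$, $\alpha(r)\le 2r$ for $r\le R_2$, and $\alpha(r)\le 3r$ for $r\le R_3$. For $r>R_3$, an interleaving may not exist.
   Context: $\mathbf X$ is a set of points with a pairwise dissimilarity $d:\mathbf X\times\mathbf X\to\mathbb R_+$, extended to tuples by $d(x_0,\dots,x_k)=\max_{0\le i<j\le k}d(x_i,x_j)$, with $d(x)=d(x,x)=0$. $\mathcal R(\mathbf X;r)$ is the Vietoris-Rips complex, consisting of all simplices $(x_0,\dots,x_k)$ with vertices in $\mathbf X$ and $d(x_0,\dots,x_k)\le r$. The Vietoris-Rips cover complex $\mathcal R(\mathbf X,\mathcal U;r)$ is the subcomplex of those simplices whose vertices all lie in some common $U\in\mathcal U$. Letting $r$ vary gives filtrations, and $H_k$ (homology with coefficients in a field) gives persistence vector spaces. Interleavings: for persistence vector spaces $V^S,W^T$ and a non-decreasing map $\alpha:S\to T$, an $\alpha$-shift map $F^\alpha:V^S\to W^T$ is a collection of linear maps $V^s\to W^{\alpha(s)}$ commuting with the structure maps of $V^S$ and $W^T$. For a non-decreasing self-map $\gamma$ of the index poset, $I^\gamma$ denotes the self-shift map given by the structure maps $V^s\to V^{\gamma(s)}$.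 An $(\alpha,\beta)$-interleaving of $V^S$ and $W^T$ is a pair of shift maps $F^\alpha:V^S\to W^T$, $G^\beta:W^T\to V^S$ with $G^\beta\circ F^\alpha\cong I^{\beta\circ\alpha}$ and $F^\alpha\circ G^\beta\cong I^{\alpha\circ\beta}$. Notation for the thresholds: $\overline{\mathcal U}=\{\bigcap_{i\in I}U_i\mid\{U_i\}_{i\in I}\subseteq\mathcal U\}$. The witness set of $x_0,\dots,x_k$ is $\mathbf X(x_0,\dots,x_k)=\{y\in\mathbf X\mid d(y,x_i)\le d(x_0,\dots,x_k)\ \forall i=0,\dots,k\}$, and $\bar{\mathbf X}(x_0,\dots,x_k)=\bigcup_{S\in\mathcal P(\{x_0,\dots,x_k\})}\mathbf X(S)$, where $\mathcal P$ denotes the power set. Put $\overline{\mathcal U}(x_0,\dots,x_k)=\{V\cap\bar{\mathbf X}(x_0,\dots,x_k)\mid V\in\overline{\mathcal U},\ \bar{\mathbf X}(x_0,\dots,x_k)\cap V\ne\emptyset\}$. $\mathcal N$ denotes the nerve of a cover (the simplicial complex whose simplices are the finite collections of sets of the cover with nonempty common intersection), and acyclic means having vanishing reduced homology. Thresholds $R_1\le R_2\le R_3$: (1) $R_1$ is the largest value so that if $d(x_0,\dots,x_k)\le R_1$ then there exists some $U\in\mathcal U$ with $x_0,\dots,x_k\in U$. (2) $R_2$ is the largest value so that if $d(x_0,\dots,x_k)\le R_2$ then $\mathcal N(\overline{\mathcal U}(x_0,\dots,x_k))$ is acyclic and $\mathbf X(x_0,\dots,x_k)\cap V$ is non-empty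 for each $V\in\overline{\mathcal U}(x_0,\dots,x_k)$. (3) $R_3$ is the largest value so that if $d(x_0,\dots,x_k)\le R_3$ then $\mathcal N(\overline{\mathcal U}(x_0,\dots,x_k))$ is acyclic.
   Formalization: The dissimilarity is also assumed to satisfy the triangle inequality (the claim fails without it); thresholds may be cuts just below a real or infinite, intersections and witness unions range over nonempty families, and the interleaving is claimed for r ≤ R_3. *)

(* Defs.v *)
From HB Require Import structures.
From mathcomp.multinomials Require Import freeg.
From mathcomp Require Import all_boot all_order all_algebra.
From mathcomp Require Import finmap.
From mathcomp Require Import all_classical interval_inference reals.

Set Implicit Arguments.
Unset Strict Implicit.
Unset Printing Implicit Defensive.

Import Order.TTheory GRing.Theory Num.Theory.

Local Open Scope classical_set_scope.
Local Open Scope quotient_scope.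
Local Open Scope ring_scope.

Section Submodules.
Variables (F : fieldType) (M : lmodType F).

Record submod := Submod {
  submod_pred :> {pred M};
  submodP : GRing.submod_closed submod_pred }.

HB.instance Definition _ (S : submod) :=
  GRing.isSubmodClosed.Build F M (submod_pred S) (submodP S).

Definition subspace (S : submod) := {x : M | submod_pred S x}.

HB.instance Definition _ (S : submod) := SubChoice.on (subspace S).
HB.instance Definition _ (S : submod) :=
  [SubChoice_isSubLmodule of subspace S by <:].

Definition quotmod (S : submod) := Quotient.quot (submod_pred S).

HB.instance Definition _ (S : submod) := GRing.Zmodule.on (quotmod S).
HB.instance Definition _ (S : submod) := Quotient.on (quotmod S).

Lemma quotmod_eqP (S : submod) (x y : M) :
  \pi_(quotmod S) x = \pi_(quotmod S) y <-> x - y \in submod_pred S.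
Proof.
split=> [e|]; first by rewrite Quotient.idealrBE; apply/eqP.
by rewrite Quotient.idealrBE => /eqP.
Qed.

Lemma quotmod_piD (S : submod) (x y : M) :
  \pi_(quotmod S) (x + y) = \pi_(quotmod S) x + \pi_(quotmod S) y.
Proof. exact: Quotient.pi_add. Qed.

Definition quotmod_scale (S : submod) (a : F) (q : quotmod S) : quotmod S :=
  \pi_(quotmod S) (a *: repr q).

Lemma quotmod_piZ (S : submod) (a : F) (x : M) :
  \pi_(quotmod S) (a *: x) = quotmod_scale a (\pi_(quotmod S) x).
Proof.
apply/quotmod_eqP; rewrite -scalerBr rpredZ //.
by apply/quotmod_eqP; rewrite reprK.
Qed.

Fact quotmod_scaleA (S : submod) a b (q : quotmod S) :
  quotmod_scale a (quotmod_scale b q) = quotmod_scale (a * b) q.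
Proof. by rewrite -[q]reprK -(quotmod_piZ _ b) -!quotmod_piZ scalerA. Qed.

Fact quotmod_scale1 (S : submod) : left_id 1 (@quotmod_scale S).
Proof. by move=> q; rewrite -[q]reprK -quotmod_piZ scale1r. Qed.

Fact quotmod_scaleDr (S : submod) : right_distributive (@quotmod_scale S) +%R.
Proof.
move=> a p q; rewrite -[p]reprK -[q]reprK -quotmod_piD -!quotmod_piZ.
by rewrite scalerDr quotmod_piD.
Qed.

Fact quotmod_scaleDl (S : submod) (q : quotmod S) :
  {morph (@quotmod_scale S)^~ q : a b / a + b}.
Proof.
by move=> a b; rewrite -[q]reprK -!quotmod_piZ scalerDl quotmod_piD.
Qed.

HB.instance Definition _ (S : submod) :=
  GRing.Zmodule_isLmodule.Build F (quotmod S)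
    (@quotmod_scaleA S) (@quotmod_scale1 S) (@quotmod_scaleDr S)
    (@quotmod_scaleDl S).

End Submodules.

Section QuotientMap.
Variables (F : fieldType) (M N : lmodType F) (S : submod M) (T : submod N).

Definition quotmod_map (g : {linear M -> N})
    of (forall x, x \in submod_pred S -> g x \in submod_pred T) :
  quotmod S -> quotmod T := fun q => \pi_(quotmod T) (g (repr q)).

Variables (g : {linear M -> N}).
Hypothesis gST : forall x, x \in submod_pred S -> g x \in submod_pred T.

Lemma quotmod_map_pi x :
  quotmod_map gST (\pi_(quotmod S) x) = \pi_(quotmod T) (g x).
Proof.
apply/quotmod_eqP; rewrite -linearB; apply: gST.
by apply/quotmod_eqP; rewrite reprK.
Qed.

Fact quotmod_map_linear : linear (quotmod_map gST).
Proof.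
move=> a p q; rewrite -[p]reprK -[q]reprK.
rewrite -[a *: _]quotmod_piZ -quotmod_piD !quotmod_map_pi.
by rewrite linearP quotmod_piD quotmod_piZ.
Qed.

HB.instance Definition _ :=
  GRing.isLinear.Build F (quotmod S) (quotmod T) *:%R (quotmod_map gST)
    quotmod_map_linear.

End QuotientMap.

Record complex (V : choiceType) := Complex {
  simplices :> {fset V} -> Prop;
  simplex_neq0 : forall s, simplices s -> s != fset0;
  simplex_face : forall s t,
    simplices s -> (t `<=` s)%fset -> t != fset0 -> simplices t }.

Section Homology.
Variables (F : fieldType) (V : choiceType).
Implicit Types (K L : complex V) (k : nat).

(* Ordered simplicial chains: the basis in degree k consists of all sequences
   (x_0, ..., x_k), repetitions allowed, whose vertex set is a simplex.  No
   order on the vertices has to be chosen. *)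
Definition chain := {freeg (seq V) / F}.
HB.instance Definition _ := GRing.Lmodule.on chain.

Definition simplex_boundary (s : seq V) : chain :=
  \sum_(i < size s) (-1) ^+ i *: << take i s ++ drop i.+1 s >>.

(* On a sequence of length 1 this is the augmentation, with values in the line
   spanned by the empty sequence. *)
Definition boundary (c : chain) : chain := fglift simplex_boundary c.

Fact boundary_zmod_morphism : zmod_morphism boundary.
Proof. exact: lift_is_additive. Qed.
HB.instance Definition _ :=
  GRing.isZmodMorphism.Build chain chain boundary boundary_zmod_morphism.

Lemma boundaryU a s : boundary << a *g s >> = a *: simplex_boundary s.
Proof. exact: liftU. Qed.

Fact boundary_scalable : scalable boundary.
Proof.
move=> a c; rewrite -[in RHS](freeg_sumE c) [in RHS](raddf_sum boundary).
rewrite scaler_sumr [LHS](raddf_sum boundary).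
by apply: eq_bigr => s _; rewrite /= !boundaryU scalerA.
Qed.
HB.instance Definition _ :=
  GRing.isScalable.Build F chain chain *:%R boundary boundary_scalable.

Definition chain_on K k (c : chain) : Prop :=
  forall s, s \in dom c -> size s = k.+1 /\ K [fset x in s]%fset.

Lemma chain_on0 K k : chain_on K k 0.
Proof. by move=> s; rewrite dom0. Qed.

Lemma chain_onP K k a (c e : chain) :
  chain_on K k c -> chain_on K k e -> chain_on K k (a *: c + e).
Proof.
move=> hc he s /domD_subset; rewrite mem_cat => /orP[/domZ_subset|].
  exact: hc.
exact: he.
Qed.

(* [aug] selects the augmented complex, i.e. reduced homology. *)
Definition cycle_pred (aug : bool) K k : {pred chain} := fun c =>
  `[< chain_on K k c /\ (aug || (0 < k)%N -> boundary c = 0) >].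

Fact cycle_submod_closed aug K k : GRing.submod_closed (cycle_pred aug K k).
Proof.
split=> [|a c e]; rewrite /cycle_pred !unfold_in.
  by apply/asboolP; split=> [|_]; [exact: chain_on0 | rewrite linear0].
move=> /asboolP[hc bc] /asboolP[he be]; apply/asboolP; split.
  exact: chain_onP.
by move=> h; rewrite linearP /= bc // be // scaler0 addr0.
Qed.

Definition cycles aug K k := Submod (cycle_submod_closed aug K k).

Definition boundary_pred aug K k : {pred subspace (cycles aug K k)} := fun z =>
  `[< exists2 b : chain, chain_on K k.+1 b & boundary b = val z >].

Fact boundary_submod_closed aug K k :
  GRing.submod_closed (@boundary_pred aug K k).
Proof.
split=> [|a z w]; rewrite /boundary_pred !unfold_in.
  by apply/asboolP; exists 0; [exact: chain_on0 | rewrite !linear0].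
move=> /asboolP[b hb bz] /asboolP[c hc cw]; apply/asboolP.
exists (a *: b + c); first exact: chain_onP.
by rewrite !linearP /= bz cw.
Qed.

Definition boundaries aug K k := Submod (@boundary_submod_closed aug K k).

Definition homology aug K k := quotmod (boundaries aug K k).
HB.instance Definition _ aug K k := GRing.Lmodule.on (homology aug K k).
HB.instance Definition _ aug K k := Quotient.on (homology aug K k).

Definition acyclic K : Prop :=
  (exists s, K s) /\ forall k (h : homology true K k), h = 0.

Section Inclusion.
Variables (aug : bool) (k : nat) (K L : complex V).
Hypothesis sKL : simplices K `<=` simplices L.

Lemma chain_onS j c : chain_on K j c -> chain_on L j c.
Proof. by move=> h s /h[? /sKL]. Qed.

Fact cycle_incl_proof (z : subspace (cycles aug K k)) :
  cycle_pred aug L k (val z).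
Proof.
by case: z => c /= /asboolP[hc bc]; apply/asboolP; split=> //; exact: chain_onS.
Qed.

Definition cycle_incl (z : subspace (cycles aug K k)) :
  subspace (cycles aug L k) := exist _ (val z) (cycle_incl_proof z).

Fact cycle_incl_linear : linear cycle_incl.
Proof. by move=> a z w; apply: val_inj; rewrite [RHS]linearP; exact: (linearP val). Qed.
HB.instance Definition _ :=
  GRing.isLinear.Build F _ _ *:%R cycle_incl cycle_incl_linear.

Fact cycle_incl_boundary z :
  z \in submod_pred (boundaries aug K k) ->
  cycle_incl z \in submod_pred (boundaries aug L k).
Proof.
move=> /asboolP[b hb bz]; apply/asboolP; exists b => //; exact: chain_onS.
Qed.

Definition homology_incl : {linear homology aug K k -> homology aug L k} :=
  quotmod_map cycle_incl_boundary.

Lemma homology_incl_pi z :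
  homology_incl (\pi_(homology aug K k) z) = \pi_(homology aug L k) (cycle_incl z).
Proof. exact: quotmod_map_pi. Qed.

End Inclusion.
End Homology.

Section Persistence.
Variable F : fieldType.

Record pvect (dS : Order.disp_t) (S : porderType dS) := PVect {
  pv_space :> S -> lmodType F;
  pv_map : forall s s', (s <= s')%O -> {linear pv_space s -> pv_space s'};
  pv_map_id : forall s (h : (s <= s)%O) x, pv_map h x = x;
  pv_map_comp : forall s s' s'' (h : (s <= s')%O) (h' : (s' <= s'')%O)
    (h'' : (s <= s'')%O) x, pv_map h' (pv_map h x) = pv_map h'' x }.
Arguments pv_map {dS S} _ {s s'} h.

Section Interleaving.
Variables (dS dT : Order.disp_t) (S : porderType dS) (T : porderType dT).

(* Shift maps and interleavings with the source parameters restricted to the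
   sets D and E; with D = E = setT these are the unrestricted notions. *)
Definition shift_map (D : set S) (alpha : S -> T) (V : pvect S) (W : pvect T)
    (f : forall s, {linear V s -> W (alpha s)}) : Prop :=
  forall s s' (h : (s <= s')%O) (h' : (alpha s <= alpha s')%O), D s -> D s' ->
  forall x, pv_map W h' (f s x) = f s' (pv_map V h x).

End Interleaving.

Definition interleaved_on (dS dT : Order.disp_t) (S : porderType dS)
    (T : porderType dT) (D : set S) (E : set T)
    (alpha : S -> T) (beta : T -> S) (V : pvect S) (W : pvect T) : Prop :=
  exists (f : forall s, {linear V s -> W (alpha s)})
         (g : forall t, {linear W t -> V (beta t)}),
  [/\ shift_map D f, shift_map E g,
      forall s, D s -> E (alpha s) ->
        exists h : (s <= beta (alpha s))%O,
          forall x, g (alpha s) (f s x) = pv_map V h x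
    & forall t, E t -> D (beta t) ->
        exists h : (t <= alpha (beta t))%O,
          forall y, f (beta t) (g t y) = pv_map W h y].

Section PersistentHomology.
Variables (dS : Order.disp_t) (S : porderType dS) (V : choiceType) (k : nat).
Variable K : S -> complex V.
Hypothesis K_mono :
  forall s s', (s <= s')%O -> simplices (K s) `<=` simplices (K s').

Definition persistent_map s s' (h : (s <= s')%O) :
  {linear homology F false (K s) k -> homology F false (K s') k} :=
  homology_incl F false k (K_mono h).

Fact persistent_map_id s (h : (s <= s)%O) x : persistent_map h x = x.
Proof.
rewrite -[x]reprK; apply: etrans (homology_incl_pi _ _) _.
by congr (\pi _); apply: val_inj.
Qed.

Fact persistent_map_comp s s' s'' (h : (s <= s')%O) (h' : (s' <= s'')%O)
    (h'' : (s <= s'')%O) x :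
  persistent_map h' (persistent_map h x) = persistent_map h'' x.
Proof.
rewrite -[x]reprK; move: (repr x) => z.
apply: etrans (congr1 _ (homology_incl_pi (K_mono h) z)) _.
apply: etrans (homology_incl_pi (K_mono h') _) _.
apply: etrans _ (esym (homology_incl_pi (K_mono h'') z)).
by congr (\pi _); apply: val_inj.
Qed.

Definition persistent_homology : pvect S :=
  PVect persistent_map_id persistent_map_comp.

End PersistentHomology.
End Persistence.
Arguments pv_map {F dS S} _ {s s'} h.

Section VietorisRips.
Variables (R : realType) (X : choiceType) (d : X -> X -> R).
Implicit Types (s t : {fset X}) (U : set (set X)) (r : R).

Definition dissimilarity : Prop :=
  [/\ forall x y, 0 <= d x y, forall x, d x x = 0 & forall x y, d x y = d y x].

(* Without this inequality the bound alpha(r) <= 3r can fail: points of a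
   witness set may then be arbitrarily far from each other. *)
Definition triangle : Prop := forall x y z, d x z <= d x y + d y z.

(* For a dissimilarity this is the maximum over i < j: d vanishes on the
   diagonal and is symmetric. *)
Definition diam s : R :=
  \big[Num.max/0]_(x <- s) \big[Num.max/0]_(y <- s) d x y.

Lemma diam_ge0 s : 0 <= diam s.
Proof. by rewrite /diam; elim/big_rec: _ => // x y _ h; rewrite le_max h orbT. Qed.

Lemma diamP s b : 0 <= b ->
  diam s <= b <-> forall x y, x \in s -> y \in s -> d x y <= b.
Proof.
move=> b0; split=> [h x y xs ys|h]; last first.
  rewrite /diam big_seq; apply: bigmax_le => // x xs.
  by rewrite big_seq; apply: bigmax_le => // y; exact: h.
apply: le_trans h; apply: (bigmax_sup_seq _ x) => //.
exact: (le_bigmax_seq _ y).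
Qed.

Lemma diamS s t : (t `<=` s)%fset -> diam t <= diam s.
Proof.
move=> /fsubsetP ts; apply/diamP; first exact: diam_ge0.
have /(diamP s (diam_ge0 s)) h := lexx (diam s).
by move=> x y xt yt; apply: h; exact: ts.
Qed.

Program Definition rips r : complex X :=
  @Complex X [set s | s != fset0 /\ diam s <= r] _ _.
Next Obligation. by move=> r s []. Qed.
Next Obligation.
by move=> r s t [_ hs] ts t0; split=> //; exact: le_trans (diamS ts) hs.
Qed.

Definition in_cover U s : Prop :=
  exists2 W : set X, U W & forall x, x \in s -> W x.

Program Definition cover_rips U r : complex X :=
  @Complex X [set s | rips r s /\ in_cover U s] _ _.
Next Obligation. by move=> U r s [] /simplex_neq0. Qed.
Next Obligation.
move=> U r s t [hs [W UW sW]] ts t0; split; first exact: simplex_face hs ts t0.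
by exists W => // x /(fsubsetP ts)/sW.
Qed.

Fact rips_mono (r r' : {nonneg R}) : (r <= r')%O ->
  simplices (rips r%:num) `<=` simplices (rips r'%:num).
Proof. by move=> h s [s0 hs]; split=> //; exact: le_trans hs _. Qed.

Fact cover_rips_mono U (r r' : {nonneg R}) : (r <= r')%O ->
  simplices (cover_rips U r%:num) `<=` simplices (cover_rips U r'%:num).
Proof. by move=> h s [hs sU]; split=> //; exact: rips_mono hs. Qed.

Definition rips_homology (F : fieldType) k : pvect F {nonneg R} :=
  persistent_homology F k rips_mono.

Definition cover_rips_homology (F : fieldType) U k : pvect F {nonneg R} :=
  persistent_homology F k (@cover_rips_mono U).

(* Intersections are over nonempty subfamilies and witness sets over nonempty
   S: allowing the empty ones would add X itself, as the empty intersection or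
   as the set of points subject to no condition. *)
Definition cap_closure U : set (set X) :=
  [set B | exists J : set (set X),
     [/\ J `<=` U, J !=set0 & B = \bigcap_(W in J) W]].

Definition witness s : set X := [set y | forall x, x \in s -> d y x <= diam s].

Definition witness_bar s : set X :=
  [set y | exists t, [/\ t != fset0, (t `<=` s)%fset & witness t y]].

Definition cover_bar U s : set (set X) :=
  [set B | B !=set0 /\ exists2 C, cap_closure U C & B = C `&` witness_bar s].

End VietorisRips.

Program Definition nerve (X : Type) (C : set (set X)) : complex (set X) :=
  @Complex (set X) [set A : {fset set X} | [/\ A != fset0,
    forall B, B \in A -> C B & exists x, forall B, B \in A -> B x]] _ _.
Next Obligation. by move=> X C A []. Qed.
Next Obligation.
move=> X C A A' [_ AC [x xA]] /fsubsetP sA A'0; split=> //.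
- by move=> B /sA/AC.
- by exists x => B /sA/xA.
Qed.

Section Thresholds.
Variables (R : realType) (F : fieldType) (X : choiceType) (d : X -> X -> R).
Variable U : set (set X).

(* "The largest value such that d(x_0, ..., x_k) <= value implies P" is taken
   among the cuts of the line, [BRight r] being r itself and [BLeft r] the cut
   just below r: for finite X, say, the values r for which the implication
   holds form [0, +oo[ or some [0, r[, so that no real number is the largest.
   "x <= value" reads [BRight x <= b]. *)
Definition holds_upto (P : {fset X} -> Prop) (b : itv_bound R) : Prop :=
  forall s, s != fset0 -> (BRight (diam d s) <= b)%O -> P s.

Definition is_threshold (P : {fset X} -> Prop) (b : itv_bound R) : Prop :=
  holds_upto P b /\ forall c, holds_upto P c -> (c <= b)%O.

Definition acyclic_nerve (s : {fset X}) : Prop :=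
  acyclic F (nerve (cover_bar d U s)).

Definition witnessed (s : {fset X}) : Prop :=
  forall B, cover_bar d U s B -> witness d s `&` B !=set0.

Definition thresholds (R1 R2 R3 : itv_bound R) : Prop :=
  [/\ is_threshold (in_cover U) R1,
      is_threshold (fun s => acyclic_nerve s /\ witnessed s) R2,
      is_threshold acyclic_nerve R3
    & (R1 <= R2 <= R3)%O].

End Thresholds.

(* Main.v *)
(* A chain map g from R(X; r) to R(X, U; alpha r) is built by acyclic carriers.
   The carrier of a simplex s with d(s) <= R3 consists of the simplices of
   diameter at most alpha(d(s)) that lie in a common set of U and whose vertices
   lie in bar X(s) (in s itself if d(s) <= R1).  By the triangle inequality
   bar X(s) has diameter at most 3 d(s), while a point of X(s) is within 2 d(s)
   of all of bar X(s); hence over each set of cover_bar s, all finite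
   intersections included, the carrier is a cone, and a double complex argument
   transfers acyclicity from the nerve of cover_bar s to the carrier.  The
   carrier contains s whenever s lies in a set of U, so that g is homotopic to
   the inclusion there; after inclusion in R(X; alpha r) it is carried, like the
   identity, by cones with apex a vertex of s.

   Beyond R3, take two points at distance 1 covered by two singletons: the
   cover complex never becomes connected, whereas H_0 of the Rips complex is a
   line from r = 1 on. *)

From HB Require Import structures.
Require Import Defs.
From mathcomp.multinomials Require Import freeg.
From mathcomp Require Import all_boot all_order all_algebra.
From mathcomp Require Import finmap.
From mathcomp Require Import all_classical interval_inference reals lra.

Set Implicit Arguments.
Unset Strict Implicit.
Unset Printing Implicit Defensive.

Import Order.TTheory GRing.Theory Num.Theory.
Local Open Scope classical_set_scope.
Local Open Scope ring_scope.

(** * Free modules: linear extension and supports *)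

Section FreeModules.
Variable F : fieldType.
Implicit Types K L : choiceType.

Definition lin K (M : lmodType F) (f : K -> M) (c : {freeg K / F}) : M :=
  fglift f c.

Fact lin_zmod_morphism K (M : lmodType F) (f : K -> M) :
  zmod_morphism (lin f).
Proof. exact: lift_is_additive. Qed.
HB.instance Definition _ K (M : lmodType F) (f : K -> M) :=
  GRing.isZmodMorphism.Build {freeg K / F} M (lin f) (lin_zmod_morphism f).

Lemma linU K (M : lmodType F) (f : K -> M) x : lin f << x >> = f x.
Proof. by rewrite /lin liftU scale1r. Qed.

Lemma scale_freegU K (a b : F) (x : K) :
  a *: << b *g x >> = << a * b *g x >>.
Proof.
by apply/eqP/freeg_eqP => y; rewrite coeffZ !coeffU mulrA.
Qed.

Fact lin_scalable K (M : lmodType F) (f : K -> M) : scalable (lin f).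
Proof.
move=> a c; rewrite -[in RHS](freeg_sumE c) [in RHS](raddf_sum (lin f)).
rewrite [LHS](raddf_sum (lin f)) scaler_sumr.
by apply: eq_bigr => x _; rewrite /= /lin !liftU scalerA.
Qed.
HB.instance Definition _ K (M : lmodType F) (f : K -> M) :=
  GRing.isScalable.Build F {freeg K / F} M *:%R (lin f) (lin_scalable f).

Lemma freeg_expand K (c : {freeg K / F}) :
  c = \sum_(x <- dom c) coeff x c *: << x >>.
Proof.
rewrite -[LHS]freeg_sumE; apply: eq_bigr => x _.
by rewrite scale_freegU mulr1.
Qed.

Lemma lin_expand K (M : lmodType F) (f : K -> M) (c : {freeg K / F}) :
  lin f c = \sum_(x <- dom c) coeff x c *: f x.
Proof.
rewrite {1}(freeg_expand c) linear_sum.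
by apply: eq_bigr => x _; rewrite linearZ /= linU.
Qed.

Lemma lin_id K (c : {freeg K / F}) : lin (fun x => << x >>) c = c.
Proof. by rewrite lin_expand -freeg_expand. Qed.

Definition supported K (P : K -> Prop) (c : {freeg K / F}) : Prop :=
  forall x, x \in dom c -> P x.

(** Identities between chain-level maps are checked on generators through this lemma; [P] retains
    what is known of the generators that occur in [c]. *)
Lemma linear_ext K (M : lmodType F) (P : K -> Prop)
    (g h : {linear {freeg K / F} -> M}) :
  (forall x, P x -> g << x >> = h << x >>) ->
  forall c, supported P c -> g c = h c.
Proof.
move=> gh c Pc; rewrite (freeg_expand c) !linear_sum big_seq [RHS]big_seq.
by apply: eq_bigr => x /Pc/gh; rewrite !linearZ => ->.
Qed.

Lemma supported0 K (P : K -> Prop) : supported P 0.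
Proof. by move=> x; rewrite dom0. Qed.

Lemma supportedU K (P : K -> Prop) x : P x -> supported P << x >>.
Proof. by move=> Px y; rewrite domU1 inE => /eqP->. Qed.

Lemma supportedD K (P : K -> Prop) c e :
  supported P c -> supported P e -> supported P (c + e).
Proof. by move=> Pc Pe x /domD_subset; rewrite mem_cat => /orP[/Pc|/Pe]. Qed.

Lemma supportedZ K (P : K -> Prop) a c : supported P c -> supported P (a *: c).
Proof. by move=> Pc x /domZ_subset/Pc. Qed.

Lemma supportedB K (P : K -> Prop) c e :
  supported P c -> supported P e -> supported P (c - e).
Proof.
by move=> Pc Pe; rewrite -scaleN1r; apply: supportedD => //; exact: supportedZ.
Qed.

Lemma supported_sum K (P : K -> Prop) (I : eqType) (r : seq I)
    (c : I -> {freeg K / F}) :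
  (forall i, i \in r -> supported P (c i)) -> supported P (\sum_(i <- r) c i).
Proof.
move=> h; rewrite big_seq.
by apply: (big_ind (supported P)); [exact: supported0 | exact: supportedD |].
Qed.

Lemma supported_lin K L (P : K -> Prop) (Q : L -> Prop)
    (f : K -> {freeg L / F}) :
  (forall x, P x -> supported Q (f x)) ->
  forall c, supported P c -> supported Q (lin f c).
Proof.
move=> h c Pc; rewrite (freeg_expand c) linear_sum; apply: supported_sum => x.
by move=> /Pc Px; rewrite linearZ /= linU; apply: supportedZ; exact: h.
Qed.

Lemma lin_exchange K L (M : lmodType F) (f : K -> L -> M) c e :
  lin (fun y => lin (f^~ y) c) e = lin (fun x => lin (f x) e) c.
Proof.
rewrite !lin_expand.
under eq_bigr => y _ do rewrite lin_expand scaler_sumr.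
rewrite exchange_big /=; apply: eq_bigr => x _.
rewrite lin_expand scaler_sumr; apply: eq_bigr => y _.
by rewrite !scalerA mulrC.
Qed.

Lemma supportedS K (P Q : K -> Prop) :
  (forall x, P x -> Q x) -> forall c, supported P c -> supported Q c.
Proof. by move=> PQ c Pc x /Pc/PQ. Qed.

End FreeModules.

(** * Augmented ordered chains, cones and exactness *)

Section SimplicialChains.
Variable F : fieldType.
Implicit Types V : choiceType.

Definition bd V : {freeg (seq V) / F} -> {freeg (seq V) / F} :=
  lin (@simplex_boundary F V).
HB.instance Definition _ V := GRing.Linear.on (@bd V).

Definition cone V (x : V) : {freeg (seq V) / F} -> {freeg (seq V) / F} :=
  lin (fun s => << x :: s >>).
HB.instance Definition _ V (x : V) := GRing.Linear.on (cone x).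

Lemma bd_nil V : bd << [::] : seq V >> = 0.
Proof. by rewrite /bd linU /simplex_boundary big_ord0. Qed.

Lemma bd_cons V (x : V) s : bd << x :: s >> = << s >> - cone x (bd << s >>).
Proof.
rewrite /bd !linU /simplex_boundary big_ord_recl /= expr0 scale1r drop0.
congr (_ + _); rewrite linear_sum -sumrN; apply: eq_bigr => i _.
by rewrite linearZ /= /cone linU exprS mulN1r scaleNr.
Qed.

Lemma bd_point V (x : V) : bd << [:: x] >> = << [::] >>.
Proof. by rewrite bd_cons bd_nil linear0 subr0. Qed.

Lemma bd_edge V (x y : V) : bd << [:: x; y] >> = << [:: y] >> - << [:: x] >>.
Proof. by rewrite bd_cons bd_point /cone linU. Qed.

Lemma bd_cone V (x : V) c : bd (cone x c) = c - cone x (bd c).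
Proof.
apply: (@linear_ext F _ _ xpredT (@bd V \o cone x)
  (idfun \- (cone x \o @bd V))) => // s _ /=.
by rewrite [cone x << s >>]linU bd_cons.
Qed.

Lemma bd_bd V c : bd (bd c) = 0 :> {freeg (seq V) / F}.
Proof.
apply: (@linear_ext F _ _ xpredT (@bd V \o @bd V) \0) => // s _ /=.
elim: s => [|x s IHs]; first by rewrite bd_nil linear0.
by rewrite bd_cons linearB /= bd_cone IHs linear0 subr0 subrr.
Qed.

Lemma supported_bdU V (P : seq V -> Prop) s :
  (forall t, size s = (size t).+1 -> {subset t <= s} -> P t) ->
  supported P (bd << s >>).
Proof.
move=> h; rewrite /bd linU /simplex_boundary; apply: supported_sum => i _.
apply: supportedZ; apply: supportedU; apply: h.
  rewrite size_cat size_take size_drop ltn_ord.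
  by rewrite -addnS -subSn // subSS subnKC // ltnW.
by move=> y; rewrite mem_cat => /orP[/mem_take|/mem_drop].
Qed.

(** Exactness of the augmented complex spanned by the sequences in [P]. The grading is by length,
    one more than the dimension; at [n = 0], if [P [::]] holds, [<< [::] >>] has to bound a chain of
    vertices. *)
Definition exact V (P : seq V -> Prop) : Prop := forall n c,
  supported (fun s => size s = n /\ P s) c -> bd c = 0 ->
  exists2 b, supported (fun s => size s = n.+1 /\ P s) b & bd b = c.

Lemma exact_iff V (P Q : seq V -> Prop) :
  (forall s, P s <-> Q s) -> exact P -> exact Q.
Proof.
move=> PQ eP n c Qc c0; have [|b Pb <-] := eP n c _ c0.
  by apply: supportedS Qc => s [-> /PQ].
by exists b => //; apply: supportedS Pb => s [-> /PQ].
Qed.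

(** By [bd_cone], the cone from [x] over a cycle has that cycle as its boundary. *)
Lemma exact_cone V (P : seq V -> Prop) x :
  (forall s, P s -> P (x :: s)) -> exact P.
Proof.
move=> xP n c Pc c0; exists (cone x c); last by rewrite bd_cone c0 linear0 subr0.
apply: supported_lin Pc => s [<- Ps]; apply: supportedU.
by split=> //; exact: xP.
Qed.

End SimplicialChains.

(** * Double complexes *)

Section Bichains.
Variable F : fieldType.
Implicit Types S T : choiceType.

Local Notation bichain S T := {freeg (seq S * seq T)%type / F}.

Definition row_incl S T (b : seq T) : {freeg (seq S) / F} -> bichain S T :=
  lin (fun s => << (s, b) >>).
HB.instance Definition _ S T (b : seq T) := GRing.Linear.on (@row_incl S T b).

Definition row_proj S T : bichain S T -> {freeg (seq S) / F} :=
  lin (fun p => << p.1 >>).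
HB.instance Definition _ S T := GRing.Linear.on (@row_proj S T).

Definition swap S T : bichain S T -> bichain T S :=
  lin (fun p => << (p.2, p.1) >>).
HB.instance Definition _ S T := GRing.Linear.on (@swap S T).

Definition bd_row S T : bichain S T -> bichain S T :=
  lin (fun p => row_incl p.2 (bd << p.1 >>)).
HB.instance Definition _ S T := GRing.Linear.on (@bd_row S T).

(** Conjugation by [swap] lets facts proved for rows carry over to columns. *)
Definition bd_col S T : bichain S T -> bichain S T :=
  fun c => swap (bd_row (swap c)).
HB.instance Definition _ S T :=
  GRing.Linear.copy (@bd_col S T) (@swap T S \o @bd_row T S \o @swap S T).

Lemma row_inclU S T (b : seq T) (s : seq S) : row_incl b << s >> = << (s, b) >>.
Proof. exact: linU. Qed.

Lemma swapU S T (s : seq S) (b : seq T) : swap << (s, b) >> = << (b, s) >>.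
Proof. exact: linU. Qed.

Lemma row_projU S T (s : seq S) (b : seq T) : row_proj << (s, b) >> = << s >>.
Proof. exact: linU. Qed.

Lemma bd_rowU S T (s : seq S) (b : seq T) :
  bd_row << (s, b) >> = row_incl b (bd << s >>).
Proof. exact: linU. Qed.

Lemma bd_colU S T (s : seq S) (b : seq T) :
  bd_col << (s, b) >> = swap (row_incl s (bd << b >>)).
Proof. by rewrite /bd_col /= swapU bd_rowU. Qed.

Lemma swapK S T (c : bichain S T) : swap (swap c) = c.
Proof.
apply: (@linear_ext F _ _ xpredT (@swap T S \o @swap S T) idfun) => // -[s b] _.
by rewrite /= !swapU.
Qed.

Lemma bd_row_incl S T (b : seq T) (c : {freeg (seq S) / F}) :
  bd_row (row_incl b c) = row_incl b (bd c).
Proof.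
apply: (@linear_ext F _ _ xpredT (@bd_row S T \o row_incl b)
  (row_incl b \o @bd F S)) => // s _.
by rewrite /= row_inclU bd_rowU.
Qed.

Lemma row_inclK S T (b : seq T) (c : {freeg (seq S) / F}) :
  row_proj (row_incl b c) = c.
Proof.
apply: (@linear_ext F _ _ xpredT (@row_proj S T \o row_incl b) idfun) => // s _.
by rewrite /= row_inclU row_projU.
Qed.

Lemma row_projK S T (b : seq T) (c : bichain S T) :
  supported (fun p => p.2 = b) c -> row_incl b (row_proj c) = c.
Proof.
apply: (linear_ext (g := row_incl b \o @row_proj S T) (h := idfun)) => -[s _] /= ->.
by rewrite row_projU row_inclU.
Qed.

Lemma bd_row_proj S T (c : bichain S T) : bd (row_proj c) = row_proj (bd_row c).
Proof.
apply: (@linear_ext F _ _ xpredT (@bd F S \o @row_proj S T)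
  (@row_proj S T \o @bd_row S T)) => // -[s b] _.
by rewrite /= row_projU bd_rowU row_inclK.
Qed.

Lemma bd_row_bd_row S T (c : bichain S T) : bd_row (bd_row c) = 0.
Proof.
apply: (@linear_ext F _ _ xpredT (@bd_row S T \o @bd_row S T) \0) => // -[s b] _.
by rewrite /= bd_rowU bd_row_incl bd_bd linear0.
Qed.

Lemma bd_col_bd_col S T (c : bichain S T) : bd_col (bd_col c) = 0.
Proof. by rewrite /bd_col /= swapK bd_row_bd_row linear0. Qed.

(** Both composites expand the tensor of [bd << s >>] and [bd << b >>], in the two orders of
    summation. The differentials commute without a sign, as no total complex is formed. *)
Lemma bd_row_bd_col S T (c : bichain S T) : bd_row (bd_col c) = bd_col (bd_row c).
Proof.
apply: (@linear_ext F _ _ xpredT (@bd_row S T \o @bd_col S T)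
  (@bd_col S T \o @bd_row S T)) => // -[s b] _.
rewrite /= bd_rowU bd_colU.
have swap_incl (s' : seq S) (e : {freeg (seq T) / F}) : 
      swap (row_incl s' e) = lin (fun b' => << (s', b') >>) e.
  apply: (@linear_ext F _ _ xpredT (@swap T S \o row_incl s') (lin _)) => // b' _.
  by rewrite /= row_inclU swapU linU.
have -> : bd_row (swap (row_incl s (bd << b >>))) =
    lin (fun b' => row_incl b' (bd << s >>)) (bd << b >>).
  apply: (@linear_ext F _ _ xpredT (@bd_row S T \o @swap T S \o row_incl s)
    (lin _)) => //.
  by move=> b' _; rewrite /= row_inclU swapU bd_rowU linU.
have -> : bd_col (row_incl b (bd << s >>)) =
    lin (fun s' => lin (fun b' => << (s', b') >>) (bd << b >>)) (bd << s >>).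
  apply: (@linear_ext F _ _ xpredT (@bd_col S T \o row_incl b) (lin _)) => // s' _.
  by rewrite /= row_inclU bd_colU linU swap_incl.
exact: lin_exchange.
Qed.

Definition bidegree S T (E : seq S -> seq T -> Prop) p q (st : seq S * seq T) :=
  [/\ size st.1 = p, size st.2 = q & E st.1 st.2].

Lemma supported_swap S T (P : seq S * seq T -> Prop) (Q : seq T * seq S -> Prop) c :
  (forall s b, P (s, b) -> Q (b, s)) -> supported P c -> supported Q (swap c).
Proof. by move=> PQ; apply: supported_lin => -[s b] /PQ; exact: supportedU. Qed.

(** [bd_row] fixes the second component [b], so cones whose apex depends on [b] assemble to one
    contraction of the rows over [B]. *)
Lemma row_exact S T (E : seq S -> seq T -> Prop) (B : seq T -> Prop) p q c :
    (forall b, B b -> exists x, forall s, E s b -> E (x :: s) b) ->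
    supported (fun st => bidegree E p q st /\ B st.2) c -> bd_row c = 0 ->
  exists2 e, supported (bidegree E p.+1 q) e & bd_row e = c.
Proof.
move=> coneB Pc c0.
have /boolp.choice[apex apexP] : forall b, exists ox : option S, B b ->
    exists2 x, ox = Some x & forall s, E s b -> E (x :: s) b.
  move=> b; have [/coneB[x xP]|nB] := pselect (B b); last by exists None.
  by exists (Some x) => _; exists x.
(* Rows without an apex get the value 0; they do not meet the support of [c]. *)
pose f (st : seq S * seq T) : bichain S T :=
  oapp (fun x => row_incl st.2 (cone x << st.1 >>)) 0 (apex st.2).
have h_incl b x c' : apex b = Some x ->
    lin f (row_incl b c') = row_incl b (cone x c').
  move=> bx; apply: (@linear_ext F _ _ xpredT (lin f \o row_incl b)
    (row_incl b \o cone x)) => // s _.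
  by rewrite /= row_inclU linU /f /= bx.
have hP : bd_row (lin f c) = c - lin f (bd_row c).
  apply: (linear_ext (g := @bd_row S T \o lin f)
    (h := idfun \- (lin f \o @bd_row S T))) Pc => -[s b] [_ /= Bb].
  have [x bx _] := apexP b Bb.
  rewrite /= linU /f /= bx /= bd_row_incl bd_rowU [lin f _](h_incl _ x) // bd_cone.
  by rewrite linearB /= row_inclU.
exists (lin f c); last by rewrite hP c0 linear0 subr0.
apply: supported_lin Pc => -[s b] [[/= <- <- Es] Bb].
have [x bx xP] := apexP b Bb; rewrite /f /= bx /= /cone linU row_inclU.
by apply: supportedU; split=> //; exact: xP.
Qed.

(* Augmented double complex: all columns and all rows but the one at [b = nil]
   are exact, hence so is that one.  The chase fills a cycle along its column,
   recurses on the row boundary of the filler in the column to its left, and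
   corrects the filler so that it becomes a row boundary itself. *)
Lemma double_complex_exact S T (E : seq S -> seq T -> Prop) :
    (forall s b s' b', E s b -> {subset s' <= s} -> {subset b' <= b} -> E s' b') ->
    (forall s, s != [::] -> E s [::] ->
       exists y, forall b, E s b -> E s (y :: b)) ->
    (forall b, b != [::] -> E [::] b ->
       exists x, forall s, E s b -> E (x :: s) b) ->
    exact F (E [::]) ->
  exact F (E^~ [::]).
Proof.
move=> Eface Ecol Erow Enil.
have bd_rowS p q c : supported (bidegree E p.+1 q) c ->
    supported (bidegree E p q) (bd_row c).
  apply: supported_lin => -[s b] [/= sp bq Esb].
  have : supported (fun t => size t = p /\ E t b) (bd << s >> : {freeg (seq S) / F}).
    apply: supported_bdU => t; rewrite sp => -[<-] ts; split=> //.
    exact: Eface Esb ts _.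
  by apply: supported_lin => t [tp Et]; exact: supportedU.
have bd_colS p q c : supported (bidegree E p q.+1) c ->
    supported (bidegree E p q) (bd_col c).
  move=> Pc; apply: (supported_swap (P := bidegree (fun b s => E s b) q p)).
    by move=> s b [].
  apply: (supported_lin (P := bidegree (fun b s => E s b) q.+1 p)).
    move=> [b s] [/= bq sp Esb].
    have : supported (fun t => size t = q /\ E s t) (bd << b >> : {freeg (seq T) / F}).
      apply: supported_bdU => t; rewrite bq => -[<-] tb; split=> //.
      exact: Eface Esb _ tb.
    by apply: supported_lin => t [tp Et]; exact: supportedU.
  by apply: supported_swap Pc => s b [].
have col_exact p q c : supported (bidegree E p q) c -> bd_col c = 0 ->
    exists2 e, supported (bidegree E p q.+1) e & bd_col e = c.
  case: p => [|p] Pc c0.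
    (* At [p = 0] the first component is the empty sequence, so [c] amounts to a chain of sequences
       in [T], and exactness of [E [::]] applies. *)
    pose c' := row_proj (swap c).
    have c'E : swap (row_incl [::] c') = c.
      rewrite -[RHS]swapK; congr swap; apply: row_projK.
      by apply: supported_swap Pc => s b [/= /size0nil].
    have [||e Pe ce] := Enil q c'.
    - apply: (supported_lin (P := bidegree (fun b s => E s b) q 0)).
        by move=> [b s] [/= bq /size0nil -> ?]; exact: supportedU.
      by apply: supported_swap Pc => s b [].
    - by rewrite bd_row_proj -[bd_row _]swapK -/(bd_col c) c0 !linear0.
    exists (swap (row_incl [::] e)).
      apply: (supported_swap (P := bidegree (fun b s => E s b) q.+1 0)).
        by move=> b s [].
      by apply: supported_lin Pe => b [bq Eb]; exact: supportedU.
    by rewrite /bd_col swapK bd_row_incl ce.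
  have [|||e Pe ce] := @row_exact T S (fun b s => E s b)
    (fun s => s != [::] /\ E s [::]) q p.+1 (swap c).
  - by move=> s [s0 Es]; exact: Ecol.
  - apply: supported_swap Pc => s b [/= sp bq Es]; split=> //=; split.
      by rewrite -size_eq0 sp.
    by apply: Eface Es _ _.
  - by rewrite -[bd_row _]swapK -/(bd_col c) c0 linear0.
  exists (swap e); last by rewrite /bd_col swapK ce swapK.
  by apply: supported_swap Pe => b s [].
have row_filler p q c : supported (bidegree E p q.+1) c -> bd_row c = 0 ->
    exists2 e, supported (bidegree E p.+1 q.+1) e & bd_row e = c.
  move=> Pc; apply: (row_exact (B := fun b => b != [::] /\ E [::] b)).
    by move=> b [b0 Eb]; exact: Erow.
  move=> [s b] /Pc[/= sp bq Es]; split=> //=; split; first by rewrite -size_eq0 bq.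
  by apply: Eface Es _ _.
have bd_row0 q c : supported (bidegree E 0 q) c -> bd_row c = 0.
  apply: (linear_ext (g := @bd_row S T) (h := \0)) => -[s b] [/= /size0nil -> _ _].
  by rewrite bd_rowU bd_nil linear0.
have diagonal_filler p q c : supported (bidegree E p q) c ->
    bd_row c = 0 -> bd_col c = 0 ->
    exists2 z, supported (bidegree E p.+1 q.+1) z & bd_row (bd_col z) = c.
  elim: p q c => [|p IHp] q c Pc row0 col0; have [e Pe ce] := col_exact _ _ _ Pc col0.
    have [z Pz ze] := row_filler _ _ _ Pe (bd_row0 _ _ Pe).
    by exists z; rewrite // bd_row_bd_col ze.
  have [||z' Pz' z'e] := IHp _ (bd_row e) (bd_rowS _ _ _ Pe).
  - exact: bd_row_bd_row.
  - by rewrite -bd_row_bd_col ce.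
  have [||z Pz ze] := row_filler p.+1 q (e - bd_col z').
  - by apply: supportedB => //; exact: bd_colS.
  - by rewrite linearB /= z'e subrr.
  exists z => //.
  by rewrite bd_row_bd_col ze linearB /= bd_col_bd_col subr0.
move=> n c Pc c0.
(* The cycle is a column cycle as well, because [bd << [::] >> = 0]. Hence it equals
   [bd_row (bd_col z)], where [bd_col z] lies in the row [b = [::]] again and is the filler
   sought. *)
have [|||z Pz ze] := diagonal_filler n 0 (row_incl [::] c).
- by apply: supported_lin Pc => s [sn Es]; exact: supportedU.
- by rewrite bd_row_incl c0 linear0.
- rewrite /row_incl.
  apply: (linear_ext (g := @bd_col S T \o row_incl [::]) (h := \0)) Pc => s _ /=.
  by rewrite row_inclU bd_colU bd_nil !linear0.
exists (row_proj (bd_col z)); last by rewrite bd_row_proj ze row_inclK.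
move: (bd_colS _ _ _ Pz); apply: supported_lin => -[s b] [/= sn /size0nil -> Es].
exact: supportedU.
Qed.

End Bichains.

(** * Acyclic carriers *)

Section AcyclicCarriers.
Variables (F : fieldType) (V : choiceType).
Variables (S : seq V -> Prop) (Phi : seq V -> seq V -> Prop).
Hypothesis S_face : forall s t, S s -> {subset t <= s} -> S t.
Hypothesis Phi_mono : forall s t u, S s -> {subset t <= s} -> Phi t u -> Phi s u.
Hypothesis Phi_exact : forall s, S s -> s != [::] -> exact F (Phi s).

Local Notation chains := {freeg (seq V) / F}.

Lemma supported_bd_face s : S s ->
  supported (fun t => size s = (size t).+1 /\ S t /\ {subset t <= s})
    (bd << s >> : chains).
Proof.
by move=> Ss; apply: supported_bdU => t st ts; split=> //; split=> //; exact: S_face ts.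
Qed.

(* The sign [e] and the degree [j] cover the construction of a chain map
   ([j = 0], [e = -1], [w = 0]) and of a chain homotopy ([j = 1], [e = 1],
   [w] the difference of two chain maps). *)
Lemma carrier_recursion (j : nat) (e : F) (w : seq V -> chains) (v0 : chains) :
    supported (fun u => size u = j /\ Phi [::] u) v0 -> bd v0 = w [::] ->
    (forall s, S s ->
       supported (fun u => (size u).+1 = (size s + j)%N /\ Phi s u) (w s)) ->
    (forall s, S s -> bd (w s) = e *: lin w (bd << s >>)) ->
  exists2 f : seq V -> chains, f [::] = v0 & forall s, S s ->
    supported (fun u => size u = (size s + j)%N /\ Phi s u) (f s) /\
    bd (f s) = w s - e *: lin f (bd << s >>).
Proof.
move=> v0P bd0 wP bdw.
have /boolp.choice[fill fillP] : forall sc : seq V * chains, exists b : chains,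
    (exists2 b' : chains,
      supported (fun u => size u = (size sc.1 + j)%N /\ Phi sc.1 u) b' &
      bd b' = sc.2) ->
    supported (fun u => size u = (size sc.1 + j)%N /\ Phi sc.1 u) b /\
    bd b = sc.2.
  move=> sc; have [[b Pb bc]|nb] := pselect (exists2 b' : chains,
      supported (fun u => size u = (size sc.1 + j)%N /\ Phi sc.1 u) b' &
      bd b' = sc.2); first by exists b.
  by exists 0 => /nb.
(* Recursion on the length, with fuel: [f n] is final on the sequences of [S] of length at most [n].
   The start value is seen only at [[::]], where it is the right one. *)
pose f n : seq V -> chains := iter n (fun g s =>
  if s is [::] then v0 else fill (s, w s - e *: lin g (bd << s >>))) (fun=> v0).
have f_stable n m s : S s -> (size s <= n)%N -> (size s <= m)%N -> f n s = f m s.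
  elim: n m s => [|n IHn] [|m] [|x s] //= Ss sn sm.
  congr (fill (_, _ - e *: _)).
  apply: (linear_ext (g := lin (f n)) (h := lin (f m))) (supported_bd_face Ss).
  by move=> t [[st] [St _]]; rewrite /= !linU; apply: IHn; rewrite // -st.
exists (fun s => f (size s) s) => // s.
have [n] := ubnP (size s); elim: n s => // n IHn s /ltnSE sn Ss.
set g := fun s => f (size s) s.
have [s0|s0] := eqVneq s [::].
  by subst s; rewrite bd_nil linear0 scaler0 subr0.
have gs : g s = fill (s, w s - e *: lin g (bd << s >>)).
  rewrite /g; case: s s0 {sn} Ss => // x s _ Ss /=.
  congr (fill (_, _ - e *: _)).
  apply: (linear_ext (g := lin (f _)) (h := lin g)) (supported_bd_face Ss).
  by move=> t [[st] [St _]]; rewrite /= !linU; apply: f_stable; rewrite // st.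
rewrite -/(g s) gs; apply: fillP => /=.
have IH t : size s = (size t).+1 -> S t ->
    supported (fun u => size u = (size t + j)%N /\ Phi t u) (g t) /\
    bd (g t) = w t - e *: lin g (bd << t >>).
  by move=> st; apply: IHn; rewrite -st.
have supp : supported (fun u => (size u).+1 = (size s + j)%N /\ Phi s u)
    (w s - e *: lin g (bd << s >>)).
  apply: supportedB; first exact: wP.
  apply: supportedZ; apply: supported_lin (supported_bd_face Ss) => t [st [St ts]].
  apply: supportedS (IH t st St).1 => u [-> tu]; split; first by rewrite st.
  exact: Phi_mono tu.
(* The chain to be filled is one vertex shorter than its filler, whence the predecessor; [s] is
   nonempty, so nothing is truncated. *)
have [||b Pb be] := Phi_exact Ss s0 (n := (size s + j).-1)
  (c := w s - e *: lin g (bd << s >>)).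
- by apply: supportedS supp => u [<-].
(* Cycle condition: by induction [bd (lin g (bd << s >>))] is [lin w (bd << s >>)] up to a term in
   [bd (bd << s >>) = 0], and [e] times it cancels [bd (w s)]. *)
- rewrite linearB linearZ /= bdw // -scalerBr.
  have -> : bd (lin g (bd << s >>)) = lin w (bd << s >>) - e *: lin g (bd (bd << s >>)).
    apply: (linear_ext (g := @bd F V \o lin g)
      (h := lin w \- (e *: (lin g \o @bd F V)))) (supported_bd_face Ss).
    by move=> t [st [St ts]] /=; rewrite /= !linU (IH t st St).2.
  by rewrite bd_bd linear0 scaler0 subr0 subrr scaler0.
exists b => //; apply: supportedS Pb => u [-> su]; split=> //.
by rewrite prednK // addn_gt0 lt0n size_eq0 s0.
Qed.

(** Chain maps carried by [Phi]; the value at [[::]] says that they preserve the augmentation. *)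
Definition carried (phi : seq V -> chains) : Prop :=
  phi [::] = << [::] >> /\ forall s, S s ->
    supported (fun u => size u = size s /\ Phi s u) (phi s) /\
    bd (phi s) = lin phi (bd << s >>).

Lemma carried_exists : Phi [::] [::] -> exists phi, carried phi.
Proof.
move=> Phi0.
have [||||phi phi0 phiP] := @carrier_recursion 0 (-1) (fun=> 0) << [::] >>.
- by apply: supportedU.
- by rewrite bd_nil.
- by move=> s _; exact: supported0.
- move=> s Ss; rewrite linear0 lin_expand big1 ?scaler0 // => *.
  by rewrite scaler0.
exists phi; split=> // s Ss; have [supp bds] := phiP s Ss; split.
  by apply: supportedS supp => u; rewrite addn0.
by rewrite bds scaleN1r opprK add0r.
Qed.

Lemma carried_homotopic phi psi k c : carried phi -> carried psi ->
  supported (fun s => size s = k.+1 /\ S s) c -> ((0 < k)%N -> bd c = 0) ->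
  exists2 D : seq V -> chains, forall s, S s ->
    supported (fun u => size u = (size s).+1 /\ Phi s u) (D s) &
    bd (lin D c) = lin phi c - lin psi c.
Proof.
move=> [phi0 phiP] [psi0 psiP] Pc bdc.
have [||||D D0 DP] := @carrier_recursion 1 1 (fun s => phi s - psi s) 0.
- exact: supported0.
- by rewrite linear0 phi0 psi0 subrr.
- move=> s Ss; apply: supportedB.
    by apply: supportedS (phiP s Ss).1 => u [-> ?]; rewrite addn1.
  by apply: supportedS (psiP s Ss).1 => u [-> ?]; rewrite addn1.
- move=> s Ss; rewrite linearB /= (phiP s Ss).2 (psiP s Ss).2 scale1r.
  apply/esym.
  apply: (@linear_ext F _ _ xpredT (lin _) (lin phi \- lin psi)) => // t _ /=.
  by rewrite !linU.
exists D.
  by move=> s /DP[supp _]; apply: supportedS supp => u; rewrite addn1.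
have -> : bd (lin D c) = lin phi c - lin psi c - lin D (bd c).
  apply: (linear_ext (g := @bd F V \o lin D)
    (h := lin phi \- lin psi \- (lin D \o @bd F V))) Pc => s [_ Ss] /=.
  by rewrite !linU (DP s Ss).2 scale1r.
(* In degree 0 the homology is not reduced, and [bd c] may be a nonzero multiple of [<< [::] >>].
   The term [lin D (bd c)] still vanishes, because [D [::] = 0]. *)
case: k Pc bdc => [Pc _|k _ ->//]; last by rewrite linear0 subr0.
have Pbd : supported (fun s : seq V => s = [::]) (bd c).
  apply: supported_lin Pc => s [s1 Ss].
  have := supported_bd_face Ss; rewrite /bd linU.
  by apply: supportedS => t; rewrite s1 => -[[/esym/size0nil]].
rewrite [lin D _](linear_ext (g := lin D) (h := \0) _ Pbd) ?subr0 // => t ->.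
by rewrite /= linU.
Qed.

End AcyclicCarriers.

(** * From chains to homology *)

Section HomologyMaps.
Variables (F : fieldType) (V : choiceType).
Implicit Types K L : complex V.

Local Open Scope quotient_scope.

(** Nonemptiness gives exactness at length 0, a vertex having boundary [<< [::] >>]; vanishing of
    reduced homology in degree [k] gives it at length [k.+1]. *)
Lemma acyclic_exact K : acyclic F K ->
  exact F (fun s => s = [::] \/ K [fset x in s]%fset).
Proof.
move=> [[s0 Ks0] H0] [|k] c Pc c0.
  have {}Pc : supported (fun s => s = [::]) c by move=> s /Pc[/size0nil].
  have /fset0Pn[x xs0] := simplex_neq0 Ks0.
  exists (coeff [::] c *: << [:: x] >>).
    apply: supportedZ; apply: supportedU; split; [by []|right].
    have x0 : x \in [fset y in [:: x]]%fset by rewrite !inE eqxx.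
    refine (simplex_face Ks0 _ _); last by apply/fset0Pn; exists x.
    by apply/fsubsetP => y; rewrite !inE orbF => /eqP->.
  rewrite linearZ /= bd_point scale_freegU mulr1.
  apply/eqP/freeg_eqP => s; rewrite coeffU.
  have [<-|s0'] := eqVneq [::] s; first by rewrite mulr1.
  rewrite mulr0 coeff_outdom //; apply/negP => /Pc ss.
  by rewrite ss eqxx in s0'.
have cP : cycle_pred true K k c.
  apply/asboolP; split=> [s /Pc[sk [s0'|//]]|_]; last exact: c0.
  by rewrite s0' in sk.
pose z : subspace (cycles F true K k) := exist _ c cP.
have : \pi_(homology F true K k) z = \pi_(homology F true K k) 0.
  by rewrite [LHS]H0 [RHS]H0.
move=> /quotmod_eqP; rewrite subr0 => /asboolP[b Pb bc].
exists b; last exact: bc.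
by move=> s /Pb[-> ?]; split=> //; right.
Qed.

Lemma homology_pi_linear aug K k a (z w : subspace (cycles F aug K k)) :
  \pi_(homology F aug K k) (a *: z + w) =
  a *: \pi_(homology F aug K k) z + \pi_(homology F aug K k) w.
Proof.
apply: etrans (quotmod_piD _ _ _) _; congr (_ + _).
exact: quotmod_piZ.
Qed.

Lemma homology_pi0 aug K k : \pi_(homology F aug K k) 0 = 0.
Proof.
have := homology_pi_linear 1 (0 : subspace (cycles F aug K k)) 0.
by rewrite !scale1r !addr0 -[LHS]addr0 => /addrI.
Qed.

Lemma exact_acyclic K : (exists s, K s) ->
  exact F (fun s => s = [::] \/ K [fset x in s]%fset) -> acyclic F K.
Proof.
move=> Ks eK; split=> // k h; rewrite -[h]reprK; move: (repr h) => z.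
have [zK bz] := asboolP _ (valP z).
have [||b Pb bc] := eK k.+1 (val z).
- by move=> s /zK[-> ?]; split=> //; right.
- exact: bz.
rewrite -homology_pi0; apply/quotmod_eqP; rewrite subr0; apply/asboolP; exists b => //.
by move=> s /Pb[sk [s0|//]]; rewrite s0 in sk.
Qed.

Section Induced.
Variables (K L : complex V) (k : nat) (phi : seq V -> {freeg (seq V) / F}).
Hypothesis phi_on : forall s : seq V, K [fset x in s]%fset ->
  supported (fun u => size u = size s /\ L [fset x in u]%fset) (phi s).
Hypothesis bd_phi : forall s : seq V, K [fset x in s]%fset ->
  bd (phi s) = lin phi (bd << s >>).

Lemma chain_on_lin j (c : chain F V) : chain_on K j c -> chain_on L j (lin phi c).
Proof. by apply: supported_lin => s [<- /phi_on]. Qed.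

Lemma boundary_lin j (c : chain F V) : chain_on K j c ->
  boundary (lin phi c : chain F V) = lin phi (boundary c).
Proof.
apply: (linear_ext (g := @bd F V \o lin phi) (h := lin phi \o @bd F V)) => s.
by move=> [_ /bd_phi] /=; rewrite linU.
Qed.

Fact cycle_lin_proof (z : subspace (cycles F false K k)) :
  cycle_pred false L k (lin phi (val z) : chain F V).
Proof.
case: z => c /= /asboolP[hc bc]; apply/asboolP; split; first exact: chain_on_lin.
by move=> k0; rewrite (boundary_lin hc) bc // linear0.
Qed.

Definition cycle_lin (z : subspace (cycles F false K k)) :
  subspace (cycles F false L k) := 
    exist _ (lin phi (val z) : chain F V) (cycle_lin_proof z).

Fact cycle_lin_linear : linear cycle_lin.
Proof.
move=> a z w; apply: val_inj; rewrite [RHS]linearP.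
exact: etrans (congr1 (lin phi) (linearP val a z w)) (linearP _ _ _ _).
Qed.
HB.instance Definition _ :=
  GRing.isLinear.Build F _ _ *:%R cycle_lin cycle_lin_linear.

Fact cycle_lin_boundary z :
  z \in submod_pred (boundaries F false K k) ->
  cycle_lin z \in submod_pred (boundaries F false L k).
Proof.
move=> /asboolP[b hb bz]; apply/asboolP; exists (lin phi b).
  exact: chain_on_lin.
by rewrite (boundary_lin hb) bz.
Qed.

Definition homology_map : {linear homology F false K k -> homology F false L k} :=
  quotmod_map cycle_lin_boundary.

Lemma homology_map_pi z :
  homology_map (\pi_(homology F false K k) z) =
  \pi_(homology F false L k) (cycle_lin z).
Proof. exact: quotmod_map_pi. Qed.

End Induced.

Lemma homology_piP aug K k (z w : subspace (cycles F aug K k)) b :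
  chain_on K k.+1 b -> boundary b = val z - val w ->
  \pi_(homology F aug K k) z = \pi_(homology F aug K k) w.
Proof.
by move=> hb bzw; apply/quotmod_eqP/asboolP; exists b.
Qed.

(** The homotopy from [carried_homotopic] bounds the difference of the two images. It stays in [L]
    because the carriers of the simplices of [K] do. *)
Lemma homology_carried (S : seq V -> Prop) (Phi : seq V -> seq V -> Prop)
    (phi psi : seq V -> {freeg (seq V) / F}) K L k
    (z : subspace (cycles F false K k)) (w w' : subspace (cycles F false L k)) :
    (forall s t : seq V, S s -> {subset t <= s} -> S t) ->
    (forall s t u : seq V, S s -> {subset t <= s} -> Phi t u -> Phi s u) ->
    (forall s, S s -> s != [::] -> exact F (Phi s)) ->
    carried S Phi phi -> carried S Phi psi ->
    (forall s : seq V, K [fset x in s]%fset -> S s) ->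
    (forall s u : seq V, K [fset x in s]%fset -> Phi s u -> u != [::] ->
      L [fset x in u]%fset) ->
    val w = lin phi (val z) -> val w' = lin psi (val z) ->
  \pi_(homology F false L k) w = \pi_(homology F false L k) w'.
Proof.
move=> Sface Phimono Phiexact phiP psiP KS KL wz w'z.
have [zK bz] := asboolP _ (valP z).
have [||D DP bD] := carried_homotopic Sface Phimono Phiexact
  (c := val z) (k := k) phiP psiP.
- by move=> s /zK[-> /KS].
- exact: bz.
apply: (homology_piP (b := lin D (val z))); last by rewrite wz w'z -bD.
apply: supported_lin zK => s [sk Ks]; apply: supportedS (DP s (KS s Ks)).
move=> u [us su]; split; first by rewrite us sk.
by apply: (KL s) => //; rewrite -size_eq0 us.
Qed.

End HomologyMaps.

(** * Carriers for the Rips and cover complexes *)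

Section RipsCarriers.
Variables (R : realType) (F : fieldType) (X : choiceType) (d : X -> X -> R).
Variables (U : set (set X)) (R1 R2 R3 : itv_bound R).
Hypotheses (dissim : dissimilarity d) (dtri : triangle d).
Hypothesis thr : thresholds F d U R1 R2 R3.
Implicit Types (s t u : seq X) (x y : X) (a r : R).

Let dxx x : d x x = 0. Proof. by case: dissim. Qed.
Let dC x y : d x y = d y x. Proof. by case: dissim. Qed.

Local Notation diams s := (diam d [fset x in s]%fset).

Lemma diam_seqP s a : 0 <= a ->
  diams s <= a <-> forall x y, x \in s -> y \in s -> d x y <= a.
Proof.
move=> a0; split=> [/(diamP _ _ a0) h x y xs ys|h].
  by apply: h; rewrite !inE.
by apply/diamP => // x y; rewrite !inE; exact: h.
Qed.

Lemma diam_seqS s t : {subset t <= s} -> diams t <= diams s.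
Proof. by move=> ts; apply: diamS; apply/fsubsetP => x; rewrite !inE; exact: ts. Qed.

(** The shift [alpha]. The factor 3 is kept beyond [R3], so that the map is monotone on the whole
    half-line. *)
Definition radius r : R :=
  if (BRight r <= R1)%O then r else if (BRight r <= R2)%O then 2 * r else 3 * r.

Lemma le_radius r : 0 <= r -> r <= radius r.
Proof. by rewrite /radius => r0; case: ifP => // _; case: ifP => _; lra. Qed.

Lemma radius_mono r r' : 0 <= r -> r <= r' -> radius r <= radius r'.
Proof.
move=> r0 rr'.
have below b : (BRight r' <= b)%O -> (BRight r <= b)%O.
  by apply: le_trans; rewrite bnd_simp.
rewrite /radius; case: (boolP (BRight r' <= R1)%O) => [/below ->//|_].
case: (boolP (BRight r' <= R2)%O) => [/below ->|_].
  by case: ifP => _; lra.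
by case: ifP => _; last case: ifP => _; lra.
Qed.

(** Up to [R1] the shift is the identity, which leaves no room for witnesses outside [s]. *)
Definition carrier_pts s x : Prop :=
  if (BRight (diams s) <= R1)%O then is_true (x \in s)
  else witness_bar d [fset x in s]%fset x.

Definition rips_carrier s u : Prop :=
  (forall x, x \in u -> carrier_pts s x) /\
  (forall x y, x \in u -> y \in u -> d x y <= radius (diams s)).

Definition seq_in_cover u : Prop :=
  u = [::] \/ exists2 W : set X, U W & forall x, x \in u -> W x.

Definition cover_carrier s u : Prop := rips_carrier s u /\ seq_in_cover u.

Definition small s : Prop := (BRight (diams s) <= R3)%O.

Lemma small_face s t : small s -> {subset t <= s} -> small t.
Proof. by move=> + /diam_seqS ts; apply: le_trans; rewrite bnd_simp. Qed.

Lemma witness_bar_self s x : x \in s -> witness_bar d [fset x in s]%fset x.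
Proof.
move=> xs; exists [fset x]%fset; split.
- by apply/fset0Pn; exists x; rewrite inE.
- by apply/fsubsetP => y; rewrite !inE => /eqP->.
- by move=> y; rewrite inE => /eqP->; rewrite dxx diam_ge0.
Qed.

Lemma witness_bar_near s y : witness_bar d [fset x in s]%fset y ->
  exists2 x, x \in s & d y x <= diams s.
Proof.
move=> [t [/fset0Pn[x xt] /[dup] /(diamS d) ts /fsubsetP tss yt]]; exists x.
  by have := tss x xt; rewrite !inE.
exact: le_trans (yt x xt) ts.
Qed.

Lemma carrier_pts_self s x : x \in s -> carrier_pts s x.
Proof. by rewrite /carrier_pts; case: ifP => // _; exact: witness_bar_self. Qed.

Lemma carrier_pts_bar s x : carrier_pts s x -> witness_bar d [fset x in s]%fset x.
Proof. by rewrite /carrier_pts; case: ifP => // _; exact: witness_bar_self. Qed.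

(** Monotonicity comes from the union over faces in [witness_bar]; the sets [witness] alone need not
    grow with [s]. A face may fall under [R1] when [s] does not, and its vertices then belong to the
    [witness_bar] of [s]. *)
Lemma rips_carrier_mono s t u : {subset t <= s} ->
  rips_carrier t u -> rips_carrier s u.
Proof.
move=> ts [uv ud]; have dts := diam_seqS ts; split.
  move=> x /uv; rewrite /carrier_pts.
  have below : (BRight (diams s) <= R1)%O -> (BRight (diams t) <= R1)%O.
    by apply: le_trans; rewrite bnd_simp.
  case: (boolP (BRight (diams s) <= R1)%O) => [/below ->|_]; first exact: ts.
  case: ifP => _; first by move=> /ts; exact: witness_bar_self.
  move=> [v [v0 /fsubsetP vt xv]]; exists v; split=> //.
  by apply/fsubsetP => y /vt; rewrite !inE; exact: ts.
move=> x y xu yu; apply: le_trans (ud x y xu yu) _.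
by apply: radius_mono => //; exact: diam_ge0.
Qed.

Lemma rips_carrier_face s u u' : rips_carrier s u -> {subset u' <= u} ->
  rips_carrier s u'.
Proof. by move=> [uv ud] su; split=> [x /su/uv|x y /su xu /su]; [|exact: ud]. Qed.

Lemma rips_carrier_self s : rips_carrier s s.
Proof.
split=> [x|x y xs ys]; first exact: carrier_pts_self.
apply: le_trans (le_radius (diam_ge0 _ _)); move: x y xs ys.
by apply/diam_seqP => //; exact: diam_ge0.
Qed.

Lemma rips_carrier_cons s x u :
  carrier_pts s x ->
  (forall y, y \in u -> carrier_pts s y -> d x y <= radius (diams s)) ->
  rips_carrier s u -> rips_carrier s (x :: u).
Proof.
move=> sx xu [uv ud]; split=> [y|y z].
  by rewrite inE => /orP[/eqP->//|/uv].
have r0 : 0 <= radius (diams s).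
  by apply: le_trans (le_radius (diam_ge0 _ _)); exact: diam_ge0.
rewrite !inE => /orP[/eqP->|yu] /orP[/eqP->|zu].
- by rewrite dxx.
- by apply: xu => //; exact: uv.
- by rewrite dC; apply: xu => //; exact: uv.
- exact: ud.
Qed.

(* A witness of the whole of [s] is within [2 * diams s] of every carrier
   point: both are within [diams s] of a common point of [s]. *)
Lemma witness_radius s y z : ~~ (BRight (diams s) <= R1)%O ->
  witness d [fset x in s]%fset y -> carrier_pts s z -> d y z <= radius (diams s).
Proof.
move=> sR1 ys /carrier_pts_bar/witness_bar_near[x xs zx].
have yx : d y x <= diams s by apply: ys; rewrite !inE.
have := dtri y x z; rewrite [d x z]dC /radius (negPf sR1) => yz.
by have := diam_ge0 d [fset x in s]%fset; case: ifP => _; lra.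
Qed.

Lemma witness_self s x : x \in s -> witness d [fset x in s]%fset x.
Proof.
move=> xs y; rewrite !inE => ys; move: x y xs ys; apply/diam_seqP => //.
exact: diam_ge0.
Qed.

(** Every vertex of [s] is a cone apex. Up to [R1] the carrier has no other points than those of
    [s]; beyond, a vertex of [s] is itself a witness of all of [s]. *)
Lemma rips_carrier_head s x u : x \in s -> rips_carrier s u ->
  rips_carrier s (x :: u).
Proof.
move=> xs; apply: rips_carrier_cons; first exact: carrier_pts_self.
move=> y _; have [sR1|sR1] := boolP (BRight (diams s) <= R1)%O.
  rewrite /carrier_pts sR1 => ys; apply: le_trans (le_radius (diam_ge0 _ _)).
  by move: x y xs ys; apply/diam_seqP => //; exact: diam_ge0.
by apply: witness_radius => //; exact: witness_self.
Qed.

Lemma rips_carrier_exact s : s != [::] -> exact F (rips_carrier s).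
Proof.
case: s => // x s _; apply: (exact_cone (x := x)) => u.
by apply: rips_carrier_head; rewrite inE eqxx.
Qed.

(** This is where closing [U] under intersections enters: a simplex of the nerve is replaced by a
    single set of [cover_bar], to which [witnessed] applies. *)
Lemma cover_bar_cap s (b : seq (set X)) x : b != [::] ->
  (forall B, B \in b -> cover_bar d U [fset x in s]%fset B) ->
  (forall B, B \in b -> B x) ->
  cover_bar d U [fset x in s]%fset [set y | forall B, B \in b -> B y].
Proof.
move=> b0 bC bx; split; first by exists x.
(* Instead of choosing a family for each [B], all members of [U] that contain some [B] are
   collected; the family defining a given [B] is among them. *)
pose J : set (set X) := [set W | U W /\ exists2 B, B \in b & B `<=` W].
have JB B : B \in b -> exists2 J' : set (set X), J' `<=` J /\ J' !=set0 &
    B = \bigcap_(W in J') W `&` witness_bar d [fset x in s]%fset.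
  move=> Bb; have [_ [C [J' [J'U J'0 ->]] BE]] := bC B Bb; exists J' => //.
  split=> // W J'W; split; first exact: J'U.
  by exists B => //; rewrite BE => y [/(_ W J'W)].
exists (\bigcap_(W in J) W).
  exists J; split=> //; first by move=> W [].
  case: b b0 {bC bx} @J JB => // B b _ J /(_ B); rewrite inE eqxx => /(_ isT).
  by move=> [J' [J'J [W /J'J JW]] _]; exists W.
apply/seteqP; split=> [y yb|y [yJ sy] B Bb].
  split=> [W [_ [B Bb]]|]; first by apply; exact: yb.
  case: b b0 yb {bC bx} @J JB => // B b _ yb J JB.
  have Bb : B \in B :: b by rewrite inE eqxx.
  by have [J' _ BE] := JB B Bb; move: (yb B Bb); rewrite BE => -[].
by have [J' [J'J _] ->] := JB B Bb; split=> // W /J'J; exact: yJ.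
Qed.

(** Beyond [R1], the double complex [E] has the carrier as its row [b = [::]] and the nerve of
    [cover_bar] as its column [u = [::]]. The latter is exact up to [R3], and the other rows and
    columns are cones. *)
Lemma cover_carrier_exact s : small s -> s != [::] -> exact F (cover_carrier s).
Proof.
move=> sR3 s0; have [sR1|sR1] := boolP (BRight (diams s) <= R1)%O.
  (* Some [W] in [U] contains all of [s], hence all carrier points: the carrier is a cone from the
     first vertex. *)
  case: s s0 sR1 {sR3} => // x s _ sR1.
  have xs : x \in x :: s by rewrite inE eqxx.
  have [[+ _] _ _ _] := thr.
  move=> /(_ [fset y in x :: s]%fset) [||W UW sW] //.
    by apply/fset0Pn; exists x; rewrite !inE eqxx.
  apply: (exact_cone (x := x)) => u [su _]; split; first exact: rips_carrier_head.
  have [xu _] := rips_carrier_head xs su.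
  right; exists W => // y /xu; rewrite /carrier_pts sR1 => ys.
  by apply: sW; rewrite in_fset.
have s0' : [fset x in s]%fset != fset0.
  by apply/fset0Pn; case: s {sR3 sR1} s0 => // x s _; exists x; rewrite !inE eqxx.
have sw u : rips_carrier s u -> forall x, x \in u -> witness_bar d [fset x in s]%fset x.
  by move=> [uv _] x /uv/carrier_pts_bar.
have barE x : witness_bar d [fset x in s]%fset x -> carrier_pts s x.
  by rewrite /carrier_pts (negPf sR1).
pose C := cover_bar d U [fset x in s]%fset.
(* The vertices of [u] lie in all sets of [b]. The last two clauses take over when [b] or [u] is
   empty: they keep [u] within one set of the cover and [b] a simplex of the nerve. *)
pose E u (b : seq (set X)) := [/\ rips_carrier s u, forall B, B \in b -> C B,
  forall x B, x \in u -> B \in b -> B x,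
  u = [::] \/ exists2 B, C B & forall x, x \in u -> B x &
  b = [::] \/ exists x, forall B, B \in b -> B x].
have subset_nil (T : eqType) (v : seq T) : {subset v <= [::]} -> v = [::].
  by case: v => // x v /(_ x); rewrite inE eqxx => /(_ isT).
have : exact F (E^~ [::]).
  apply: double_complex_exact =>
    [u b u' b' [uv bC ub uC bx] su sb|u u0 [uv _ _ uC _]|b b0 [_ bC _ _ bx]|].
  - split.
    + exact: rips_carrier_face uv su.
    + by move=> B /sb/bC.
    + by move=> x B /su xu /sb; exact: ub.
    + case: uC => [u0|[B CB uB]]; [left|right; exists B => // x /su/uB //].
      by apply: subset_nil; rewrite -u0.
    + case: bx => [b0|[x xb]]; [left|right; exists x => B /sb/xb //].
      by apply: subset_nil; rewrite -b0.
  - case: uC => [u0'|[B CB uB]]; first by rewrite u0' in u0.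
    (* A set [B] containing [u] is the apex of the column over [u]; any vertex of [u] is a common
       point of [B] and the sets of [b]. *)
    exists B => b [_ bC ub _ _]; split=> //; last 2 first.
    + by right; exists B.
    + right; case: u u0 {uv} uB ub => // x u _ uB ub; exists x => B'.
      have xu : x \in x :: u by rewrite inE eqxx.
      by rewrite inE => /orP[/eqP->|]; [exact: uB|exact: ub].
    + by move=> B'; rewrite inE => /orP[/eqP->//|/bC].
    + by move=> x B' xu; rewrite inE => /orP[/eqP->|]; [exact: uB|exact: ub].
  - case: bx => [b0'|[x0 x0b]]; first by rewrite b0' in b0.
    (* The apex of the row over [b] is a point of all sets of [b] that is close to every carrier
       point. *)
    suff [y [yb sy yu]] : exists y, [/\ forall B, B \in b -> B y,
        carrier_pts s y & forall z, carrier_pts s z -> d y z <= radius (diams s)].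
      exists y => u [uv _ ub _ _]; split=> //.
      + by apply: rips_carrier_cons => // z _; exact: yu.
      + by move=> x B; rewrite inE => /orP[/eqP->|]; [move=> /yb|exact: ub].
      + right; case: b b0 {x0b} bC ub yb => // B b _ bC ub yb; exists B.
          by apply: bC; rewrite inE eqxx.
        have Bb : B \in B :: b by rewrite inE eqxx.
        by move=> x; rewrite inE => /orP[/eqP->|xu]; [exact: yb|exact: ub].
      + by right; exists y.
    have CV := cover_bar_cap b0 bC x0b.
    (* Up to [R2], the intersection of the sets of [b] contains a witness of all of [s], which is
       within twice the diameter of every carrier point. *)
    have [sR2|sR2] := boolP (BRight (diams s) <= R2)%O.
      have [_ [+ _] _ _] := thr.
      move=> /(_ _ s0' sR2)[_ /(_ _ CV)[y [ys yb]]].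
      exists y; split=> //; last by move=> z; exact: witness_radius.
      by apply: barE; exists [fset x in s]%fset; split.
    have x0w : witness_bar d [fset x in s]%fset x0.
      have [_ [D _ DE]] := CV.
      have : [set y | forall B, B \in b -> B y] x0 by [].
      by rewrite DE => -[].
    (* Beyond [R2] any common point serves: from [x0] through [x'] and [x] in [s] to [z] there are
       three steps of length at most [diams s]. *)
    exists x0; split=> //; first exact: barE.
    move=> z /carrier_pts_bar/witness_bar_near[x xs zx].
    have [x' x's x'x] := witness_bar_near x0w.
    have xx' : d x' x <= diams s.
      by move: x' x x's xs {zx x'x}; apply/diam_seqP => //; exact: diam_ge0.
    have := dtri x0 x' z; have := dtri x' x z; rewrite [d x z]dC.
    rewrite /radius (negPf sR1) (negPf sR2); lra.
  have [_ _ [+ _] _] := thr.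
  move=> /(_ _ s0' sR3) /acyclic_exact; apply: exact_iff => b; split.
    move=> [->|[b0 bC [x xb]]].
      by split=> //; left.
    split=> //; first by move=> B Bb; apply: bC; rewrite inE.
      by left.
    by right; exists x => B Bb; apply: xb; rewrite inE.
  move=> [_ bC _ _ [->|[x xb]]]; first by left.
  have [->|b0] := eqVneq b [::]; [by left|right].
  split; last 2 first.
  - by move=> B; rewrite inE; exact: bC.
  - by exists x => B; rewrite inE; exact: xb.
  case: b b0 {bC xb} => // B b _; apply/fset0Pn; exists B.
  by rewrite inE inE eqxx.
(* The row [b = [::]] is the carrier: an intersection lies in any one of its members, and conversely
   [W] meets [witness_bar] in a set of [cover_bar], by the family [[set W]]. *)
apply: exact_iff => u; split=> [[su _ _ uC _]|[su uU]]; split=> //.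
- case: uC => [->|[B [_ [D [J [JU [W JW] ->]] ->]] uB]]; first by left.
  by right; exists W => [|x /uB[/(_ W JW)]] //; exact: JU.
- case: uU => [->|[W UW uW]]; first by left.
  case: u su uW => [|x u] su uW; first by left.
  have xW y : y \in x :: u -> (W `&` witness_bar d [fset x in s]%fset) y.
    by move=> yu; split; [exact: uW|exact: sw su y yu].
  right; exists (W `&` witness_bar d [fset x in s]%fset) => //; split.
    by exists x; apply: xW; rewrite inE eqxx.
  exists W => //; exists [set W]; split; first by move=> ? ->.
    by exists W.
  by rewrite bigcap_set1.
- by left.
Qed.

Local Open Scope quotient_scope.

Fact radius_ge0 (r : {nonneg R}) : 0 <= radius r%:num.
Proof. exact: le_trans (le_radius _). Qed.

Definition radius_nng (r : {nonneg R}) : {nonneg R} := NngNum (radius_ge0 r).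

Lemma le_radius_nng (r : {nonneg R}) : (r <= radius_nng r)%O.
Proof. by change (r%:num <= radius r%:num); exact: le_radius. Qed.

Lemma rips_small (t : {nonneg R}) s : (BRight t%:num <= R3)%O ->
  rips d t%:num [fset x in s]%fset -> small s.
Proof. by move=> tR3 [_ st]; apply: le_trans tR3; rewrite bnd_simp. Qed.

Lemma rips_neq_nil r s : rips d r [fset x in s]%fset -> s != [::].
Proof. by move=> [/fset0Pn[x]]; rewrite inE; case: s. Qed.

Lemma rips_carrier_rips (t : {nonneg R}) s u :
  rips d t%:num [fset x in s]%fset -> rips_carrier s u -> u != [::] ->
  rips d (radius_nng t)%:num [fset x in u]%fset.
Proof.
move=> [_ st] [_ ud] u0; split.
  by case: u u0 {ud} => // x u _; apply/fset0Pn; exists x; rewrite inE inE eqxx.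
apply: le_trans (radius_mono (diam_ge0 d _) st).
apply/diam_seqP => //; apply: le_trans (le_radius _); exact: diam_ge0.
Qed.

Lemma cover_carrier_rips (t : {nonneg R}) s u :
  rips d t%:num [fset x in s]%fset -> cover_carrier s u -> u != [::] ->
  cover_rips d U (radius_nng t)%:num [fset x in u]%fset.
Proof.
move=> st [su uU] u0; split; first exact: rips_carrier_rips st su u0.
case: uU => [u0'|[W UW uW]]; first by rewrite u0' in u0.
by exists W => // x; rewrite inE; exact: uW.
Qed.

(** * The interleaving induced by a carried chain map *)

Section ChainMap.
Variables (phi : seq X -> {freeg (seq X) / F}) (k : nat).
Hypothesis phiP : carried small cover_carrier phi.

Lemma rips_map (t : {nonneg R}) : exists g :
  {linear homology F false (rips d t%:num) k ->
          homology F false (cover_rips d U (radius_nng t)%:num) k},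
  (BRight t%:num <= R3)%O ->
  forall z : subspace (cycles F false (rips d t%:num) k),
  exists2 w : subspace (cycles F false (cover_rips d U (radius_nng t)%:num) k),
    val w = lin phi (val z) &
    g (\pi_(homology F false (rips d t%:num) k) z) =
    \pi_(homology F false (cover_rips d U (radius_nng t)%:num) k) w.
Proof.
(* Beyond [R3] the zero map is a placeholder, the interleaving conditions being restricted to
   parameters up to [R3]. *)
have [tR3|] := boolP (BRight t%:num <= R3)%O; last by exists \0.
have phi_on s : rips d t%:num [fset x in s]%fset ->
    supported (fun u => size u = size s /\
      cover_rips d U (radius_nng t)%:num [fset x in u]%fset) (phi s).
  move=> st; apply: supportedS (phiP.2 s (rips_small tR3 st)).1 => u [us su].
  split=> //; apply: (cover_carrier_rips st su).
  by rewrite -size_eq0 us size_eq0; exact: (rips_neq_nil st).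
have bd_phi s : rips d t%:num [fset x in s]%fset ->
    bd (phi s) = lin phi (bd << s >>).
  by move=> st; exact: (phiP.2 s (rips_small tR3 st)).2.
exists (homology_map k phi_on bd_phi) => _ z.
by exists (cycle_lin phi_on bd_phi z); rewrite // homology_map_pi.
Qed.

(** A simplex inside a set of [U] belongs to its own carrier. Hence on the cover complex the
    identity competes with [phi], and the two are homotopic. *)
Lemma carried_cover_id :
  carried (fun s => small s /\ seq_in_cover s) cover_carrier
    (fun s => << s >> : {freeg (seq X) / F}).
Proof.
split=> // s [_ sU]; split.
  by apply: supportedU; split=> //; split=> //; exact: rips_carrier_self.
by rewrite lin_id.
Qed.

(** Once the cover condition is dropped, the carrier of every small [s] contains [s], so that [phi]
    and the identity can be compared on the whole Rips complex. *)
Lemma carried_rips :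
  carried small rips_carrier phi /\
  carried small rips_carrier (fun s => << s >> : {freeg (seq X) / F}).
Proof.
split; split=> //; first exact: phiP.1.
  move=> s /phiP.2[supp bds]; split=> //.
  by apply: supportedS supp => u [-> [? _]].
move=> s _; split; first by apply: supportedU; split=> //; exact: rips_carrier_self.
by rewrite lin_id.
Qed.

Lemma rips_interleaved :
  interleaved_on setT [set r : {nonneg R} | (BRight r%:num <= R3)%O]
    id radius_nng (cover_rips_homology d F U k) (rips_homology d F k).
Proof.
have incl_sub (r : {nonneg R}) :
    simplices (cover_rips d U r%:num) `<=` simplices (rips d r%:num).
  by move=> s [].
pose g (t : {nonneg R}) := projT1 (cid (rips_map t)).
have gP (t : {nonneg R}) := projT2 (cid (rips_map t)).
exists (fun r : {nonneg R} => homology_incl F false k (incl_sub r)), g; split.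
- move=> s s' h h' _ _ x; rewrite -[x]reprK; move: (repr x) => z.
  apply: etrans (congr1 _ (homology_incl_pi (incl_sub s) z)) _.
  apply: etrans (homology_incl_pi (rips_mono h') _) _.
  apply: etrans _ (esym (congr1 _ (homology_incl_pi (cover_rips_mono h) z))).
  apply: etrans _ (esym (homology_incl_pi (incl_sub s') _)).
  by congr (\pi _); apply: val_inj.
(* A single [phi] serves all parameters, so both sides are represented by [lin phi] of the same
   chain. *)
- move=> t t' h h' tR3 t'R3 x; rewrite -[x]reprK; move: (repr x) => z.
  have [w wz gz] := gP t tR3 z.
  apply: etrans (congr1 _ gz) _.
  apply: etrans (homology_incl_pi (cover_rips_mono h') _) _.
  apply: etrans _ (esym (congr1 _ (homology_incl_pi (rips_mono h) z))).
  have [w' w'z gz'] := gP t' t'R3 (cycle_incl (rips_mono h) z).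
  by apply: etrans _ (esym gz'); congr (\pi _); apply: val_inj; rewrite w'z -wz.
- move=> s _ sR3; exists (le_radius_nng s) => x; rewrite -[x]reprK; move: (repr x) => z.
  have [w wz gz] := gP s sR3 (cycle_incl (incl_sub s) z).
  apply: etrans (congr1 _ (homology_incl_pi (incl_sub s) z)) _.
  apply: etrans gz _.
  apply: etrans _ (esym (homology_incl_pi (cover_rips_mono (le_radius_nng s)) z)).
  (* The composite on the cover complex is [phi], compared with the identity in the cover
     carriers. *)
  apply: (homology_carried (S := fun u => small u /\ seq_in_cover u)
    (Phi := cover_carrier) (z := z) _ _ _ _ carried_cover_id).
  + move=> u v [us uU] vu; split; first exact: small_face us vu.
    case: uU => [u0|[W UW uW]]; [left|right; exists W => // y /vu/uW //].
    by case: v vu => // y v /(_ y); rewrite u0 inE eqxx => /(_ isT).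
  + move=> u v v' _ vu [vv' v'U]; split=> //; exact: rips_carrier_mono vv'.
  + by move=> u [us _]; exact: cover_carrier_exact.
  + by split=> [|u [us _]]; [exact: phiP.1|exact: phiP.2].
  + move=> u [us [W UW uW]]; split; first exact: rips_small sR3 us.
    by right; exists W => // y yu; apply: uW; rewrite inE.
  + move=> u v [us _]; exact: cover_carrier_rips.
  + exact: wz.
  + by rewrite lin_id.
- move=> t tR3 _; exists (le_radius_nng t) => x; rewrite -[x]reprK; move: (repr x) => z.
  have [w wz gz] := gP t tR3 z.
  apply: etrans (congr1 _ gz) _.
  apply: etrans (homology_incl_pi (incl_sub _) _) _.
  apply: etrans _ (esym (homology_incl_pi (rips_mono (le_radius_nng t)) z)).
  (* On the Rips complex the comparison takes place in the larger carriers, after inclusion. *)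
  apply: (homology_carried (S := small) (Phi := rips_carrier) (z := z)
    _ _ _ carried_rips.1 carried_rips.2).
  + exact: small_face.
  + by move=> u v v' _; exact: rips_carrier_mono.
  + by move=> u _; exact: rips_carrier_exact.
  + by move=> u; exact: rips_small tR3.
  + exact: rips_carrier_rips.
  + exact: wz.
  + by rewrite lin_id.
Qed.

End ChainMap.

Lemma rips_interleaving_exists k :
  interleaved_on setT [set r : {nonneg R} | (BRight r%:num <= R3)%O]
    id radius_nng (cover_rips_homology d F U k) (rips_homology d F k).
Proof.
have [||||phi phiP] := @carried_exists F X small cover_carrier.
- exact: small_face.
- move=> u v v' _ vu [vv' v'U]; split=> //; exact: rips_carrier_mono vv'.
- by move=> u us; exact: cover_carrier_exact.
- by split; [exact: rips_carrier_self|left].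
exact: rips_interleaved phiP.
Qed.

End RipsCarriers.

(** * The two-point example beyond the last threshold *)

Section TwoPoints.
Variables (R : realType) (F : fieldType).
Implicit Types (s : {fset bool}) (x y : bool) (r : {nonneg R}).
Local Open Scope quotient_scope.

Definition two_dist x y : R := (x != y)%:R.

Definition singletons : set (set bool) := [set [set x] | x in [set: bool]].

Lemma two_dist_dissimilarity : dissimilarity two_dist.
Proof.
split=> [x y|x|x y]; first exact: ler0n.
  by rewrite /two_dist eqxx.
by rewrite /two_dist eq_sym.
Qed.

Lemma two_dist_triangle : triangle two_dist.
Proof.
move=> x y z; rewrite /two_dist -natrD ler_nat.
by case: x; case: y; case: z.
Qed.

Lemma diam_two_dist_lt1 s : s != fset0 -> diam two_dist s < 1 ->
  exists x, s = [fset x]%fset.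
Proof.
move=> /fset0Pn[x xs] s1; exists x; apply/fsetP => y; rewrite inE.
apply/idP/eqP => [ys|->//]; apply/eqP; rewrite -[_ == _]negbK; apply/negP => yx.
have /(diamP _ _ (diam_ge0 _ _))/(_ y x ys xs) := lexx (diam two_dist s).
by rewrite /two_dist yx leNgt s1.
Qed.

Lemma diam_two_dist_le1 s : diam two_dist s <= 1.
Proof. by apply/diamP => // x y _ _; rewrite /two_dist lern1 leq_b1. Qed.

Lemma diam_two_dist1 x : diam two_dist [fset x]%fset = 0.
Proof.
apply/le_anti; rewrite diam_ge0 andbT; apply/diamP => // y z.
by rewrite !inE => /eqP-> /eqP->; rewrite /two_dist eqxx.
Qed.

Lemma witness_bar_two x s : x \in s -> witness_bar two_dist s x.
Proof.
move=> xs; exists [fset x]%fset; split.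
- by apply/fset0Pn; exists x; rewrite inE.
- by apply/fsubsetP => y; rewrite inE => /eqP->.
- by move=> y; rewrite inE => /eqP->; rewrite diam_two_dist1 /two_dist eqxx.
Qed.

Lemma cover_bar_two s B : cover_bar two_dist singletons s B ->
  exists2 x, witness_bar two_dist s x & B = [set x].
Proof.
move=> [[x]] + [C [J [JU [W JW] ->]] BE]; rewrite BE => -[xJ xs]; exists x => //.
have [y _ yW] := JU W JW; have := xJ W JW; rewrite -yW => /= xy.
apply/seteqP; split=> z /=; last by move=> ->.
by move=> [/(_ W JW)]; rewrite -yW xy.
Qed.

Lemma cover_bar_two_set1 s x : x \in s ->
  cover_bar two_dist singletons s [set x].
Proof.
move=> xs; split; first by exists x.
exists [set x].
  exists [set [set x]]; split; last by rewrite bigcap_set1.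
    by move=> _ ->; exists x.
  by exists [set x].
apply/esym/setIidPl => _ ->; exact: witness_bar_two.
Qed.

Lemma witness_bar_two1 x y : witness_bar two_dist [fset x]%fset y -> y = x.
Proof.
move=> [t [/fset0Pn[z zt] /[dup] /(diamS two_dist) dt /fsubsetP tx yt]]; apply/eqP; rewrite -[_ == _]negbK.
apply/negP => yx; have := tx z zt; rewrite inE => /eqP zx; rewrite zx in zt.
have := le_trans (yt x zt) dt.
by rewrite diam_two_dist1 /two_dist yx ler10.
Qed.

(** Nonempty sets of diameter less than 1 are singletons, whereas any cut above [BLeft 1] lets in
    the pair. *)
Lemma is_threshold_two P :
  (forall x, P [fset x]%fset) -> ~ P [fset true; false]%fset ->
  is_threshold two_dist P (BLeft 1).
Proof.
move=> P1 P2; split=> [s s0|c Pc].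
  by rewrite bnd_simp => /(diam_two_dist_lt1 s0)[x ->].
rewrite leNgt; apply/negP => c1; apply: P2; apply: Pc.
  by apply/fset0Pn; exists true; rewrite !inE.
apply: (@le_trans _ _ (BRight 1)); first by rewrite bnd_simp diam_two_dist_le1.
by case: c c1 => [[] c|[]]; rewrite !bnd_simp.
Qed.

Lemma acyclic_nerve_two1 x :
  acyclic_nerve F two_dist singletons [fset x]%fset.
Proof.
have xx : x \in [fset x]%fset by rewrite inE.
apply: exact_acyclic.
  exists [fset [set x]]%fset; split.
  - by apply/fset0Pn; exists [set x]; rewrite inE.
  - by move=> B; rewrite inE => /eqP->; exact: cover_bar_two_set1.
  - by exists x => B; rewrite inE => /eqP->.
apply: (exact_cone (x := [set x])) => b Pb; right.
have {Pb}bC B : B \in b -> cover_bar two_dist singletons [fset x]%fset B.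
  by case: Pb => [->//|[_ bC _]] Bb; apply: bC; rewrite inE.
split; first by apply/fset0Pn; exists [set x]; rewrite inE inE eqxx.
  by move=> B; rewrite !inE => /orP[/eqP->|/bC//]; exact: cover_bar_two_set1.
exists x => B; rewrite !inE => /orP[/eqP->//|/bC/cover_bar_two].
by move=> [y /witness_bar_two1 -> ->].
Qed.

(** The nerve consists of two isolated vertices, and their difference is a reduced cycle that does
    not bound. *)
Lemma not_acyclic_nerve_two :
  ~ acyclic_nerve F two_dist singletons [fset true; false]%fset.
Proof.
set s := [fset true; false]%fset => /acyclic_exact nerve_exact.
have xs x : x \in s by rewrite !inE; case: x.
pose c : {freeg (seq (set bool)) / F} := << [:: [set true]] >> - << [:: [set false]] >>.
have pt_nerve x : nerve (cover_bar two_dist singletons s)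
    [fset B in [:: [set x]]]%fset.
  split; first by apply/fset0Pn; exists [set x]; rewrite inE inE eqxx.
    by move=> B; rewrite !inE orbF => /eqP->; exact: cover_bar_two_set1.
  by exists x => B; rewrite !inE orbF => /eqP->.
have [||b Pb bc] := nerve_exact 1 c.
- by apply: supportedB; apply: supportedU; split=> //; right.
- by rewrite linearB /= !bd_point subrr.
(* The coefficient of one vertex: it kills boundaries, since every edge of the nerve is degenerate,
   but is 1 on [c]. *)
pose l : {freeg (seq (set bool)) / F} -> F^o :=
  lin (fun u => (u == [:: [set true]])%:R : F^o).
have : l (bd b) = 0.
  apply: (linear_ext (g := lin _ \o @bd F _) (h := \0)) Pb.
  move=> u [u2 uK]; case: u u2 uK => [|B [|B' []]] // _ [//|[_ bC [x xb]]] /=.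
  have BE B0 : B0 \in [:: B; B'] -> B0 = [set x].
    move=> B0b; have [|y _ B0E] := @cover_bar_two s B0.
      by apply: bC; rewrite in_fset.
    have : B0 x by apply: xb; rewrite in_fset.
    by rewrite B0E => ->.
  have -> : B = B' by rewrite (BE _ (mem_head _ _)) (BE B' (mem_last B [:: B'])).
  by rewrite bd_edge subrr linear0.
rewrite bc /l linearB /= !linU eqxx.
have -> : ([:: [set false]] == [:: [set true]]) = false.
  apply/eqP => -[/seteqP[/(_ false erefl)]]; by [].
by rewrite subr0 => /eqP; rewrite oner_eq0.
Qed.

Lemma thresholds_two :
  thresholds F two_dist singletons (BLeft 1) (BLeft 1) (BLeft 1).
Proof.
split; last by rewrite lexx.
- apply: is_threshold_two => [x|[_ [x _ <-] sx]].
    by exists [set x]; [exists x|move=> y; rewrite inE => /eqP->].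
  have /= tx := sx true; have /= fx := sx false.
  by have := tx _; rewrite -fx // !inE // => /(_ isT).
- apply: is_threshold_two => [x|[]]; last by move=> + _; exact: not_acyclic_nerve_two.
  split; first exact: acyclic_nerve_two1.
  move=> B /cover_bar_two[y /witness_bar_two1 -> ->]; exists x; split=> //.
  by move=> y'; rewrite inE => /eqP->; rewrite diam_two_dist1 /two_dist eqxx.
- apply: is_threshold_two; [exact: acyclic_nerve_two1|exact: not_acyclic_nerve_two].
Qed.

Local Notation two_rips r := (rips two_dist r%:num).
Local Notation two_cover_rips r := (cover_rips two_dist singletons r%:num).

Lemma two_cover_rips_set1 r x : two_cover_rips r [fset y in [:: x]]%fset.
Proof.
have -> : [fset y in [:: x]]%fset = [fset x]%fset.
  by apply/fsetP => y; rewrite !inE orbF.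
split; last by exists [set x]; [exists x|move=> y; rewrite inE => /eqP].
by split; [apply/fset0Pn; exists x; rewrite inE|rewrite diam_two_dist1].
Qed.

Fact point_cycle r x :
  cycle_pred false (two_cover_rips r) 0 (<< [:: x] >> : chain F bool).
Proof.
apply/asboolP; split=> // t; rewrite domU1 inE => /eqP->; split=> //.
exact: two_cover_rips_set1.
Qed.

Definition point r x : subspace (cycles F false (two_cover_rips r) 0) :=
  exist _ (<< [:: x] >> : chain F bool) (point_cycle r x).

Definition point_class r x : homology F false (two_cover_rips r) 0 :=
  \pi_(homology F false (two_cover_rips r) 0) (point r x).

(** No edge of the cover complex joins the two points at any scale, so the coefficient of either
    point vanishes on boundaries. *)
Lemma point_class_free r a b :
  a *: point_class r true + b *: point_class r false = 0 -> a = 0 /\ b = 0.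
Proof.
have -> : a *: point_class r true + b *: point_class r false =
    \pi_(homology F false (two_cover_rips r) 0)
      (a *: point r true + (b *: point r false + 0)).
  by rewrite !homology_pi_linear homology_pi0 addr0.
rewrite -[X in _ = X]homology_pi0 => /quotmod_eqP; rewrite subr0.
move=> /asboolP[e Pe].
have -> : val (a *: point r true + (b *: point r false + 0)) =
  a *: << [:: true] >> + b *: << [:: false] >> :> {freeg (seq bool) / F}.
  by rewrite !(linearP val) linear0 addr0.
move=> be.
pose l x : {freeg (seq bool) / F} -> F^o := lin (fun u => (u == [:: x])%:R : F^o).
have le x : l x (bd e) = 0.
  apply: (linear_ext (g := lin _ \o @bd F _) (h := \0)) Pe.
  move=> u [u2 [_ [_ [y _ <-] uy]]].
  case: u u2 uy => [|y1 [|y2 []]] // _ uy /=.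
  have -> : y2 = y by apply: uy; rewrite !inE eqxx orbT.
  have -> : y1 = y by apply: uy; rewrite !inE eqxx.
  by rewrite bd_edge subrr linear0.
have lx x : l x (bd e) = a * (true == x)%:R + b * (false == x)%:R.
  rewrite [bd e]be /l linearD !linearZ /= !linU.
  by rewrite !eqseq_cons !andbT.
split.
  by have := lx true; rewrite le eqxx mulr1 mulr0 addr0.
by have := lx false; rewrite le eqxx mulr1 mulr0 add0r.
Qed.

Lemma two_rips_homology0 r : 1 <= r%:num ->
  exists e : homology F false (two_rips r) 0,
    forall h : homology F false (two_rips r) 0, exists a, h = a *: e.
Proof.
move=> r1.
have full (u : seq bool) : u != [::] -> two_rips r [fset x in u]%fset.
  case: u => // x u _; split; last exact: le_trans (diam_two_dist_le1 _) r1.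
  by apply/fset0Pn; exists x; rewrite in_fset mem_head.
have truec : cycle_pred false (two_rips r) 0 (<< [:: true] >> : chain F bool).
  apply/asboolP; split=> // t; rewrite domU1 inE => /eqP->; split=> //.
  exact: full.
pose p : subspace (cycles F false (two_rips r) 0) :=
  exist _ (<< [:: true] >> : chain F bool) truec.
exists (\pi_(homology F false (two_rips r) 0) p) => h.
rewrite -[h]reprK; move: (repr h) => z.
have [zK _] := asboolP _ (valP z).
pose c : {freeg (seq bool) / F} := val z.
(* The scalar is the augmentation of [c]: the boundary of [cone true c] is [c] minus that multiple
   of the point [true]. *)
exists (coeff [::] (bd c)).
rewrite -[RHS]addr0 -[X in _ = _ + X]homology_pi0 -homology_pi_linear addr0.
apply: (homology_piP (b := cone true c)).
  apply: supported_lin zK => s [s1 _]; apply: supportedU.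
  by split; [rewrite /= s1|exact: full].
have bdc : bd c = coeff [::] (bd c) *: << [::] >>.
  apply/eqP/freeg_eqP => t; rewrite coeffZ coeffU mul1r.
  have [<-|t0] := eqVneq [::] t; first by rewrite mulr1.
  rewrite mulr0 coeff_outdom //; apply/negP.
  have : supported (fun t : seq bool => t = [::]) (bd c).
    apply: supported_lin zK => u [u1 _].
    rewrite -[simplex_boundary F u]linU; apply: supported_bdU => v.
    by rewrite u1 => -[/esym/size0nil].
  by move=> + td => /(_ t td) t0'; rewrite t0' eqxx in t0.
apply: etrans (bd_cone true c) _; congr (_ - _).
by rewrite [in LHS]bdc [RHS]linearZ linearZ /= /cone linU.
Qed.

(** At the parameter [r0] alone, the structure map is injective on the span of the two point
    classes, yet it would factor through a line. *)
Lemma two_not_interleaved r0 (alpha : {nonneg R} -> {nonneg R}) :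
  1 <= r0%:num ->
  ~ interleaved_on setT [set r : {nonneg R} | r <= r0] id alpha
      (cover_rips_homology two_dist F singletons 0)
      (rips_homology two_dist F 0).
Proof.
move=> r1 [f [g [_ _ gf _]]].
have [h gfh] := gf r0 I (lexx r0).
have [e eP] := two_rips_homology0 r1.
have pmap x : pv_map (cover_rips_homology two_dist F singletons 0) h
    (point_class r0 x) = point_class (alpha r0) x.
  apply: etrans (homology_incl_pi (cover_rips_mono h) _) _.
  by congr (\pi _); apply: val_inj.
have ker a b : f r0 (a *: point_class r0 true + b *: point_class r0 false) = 0 ->
    a = 0 /\ b = 0.
  move=> fab; apply: (@point_class_free (alpha r0)); rewrite -!pmap -!linearZ -linearD.
  by rewrite -gfh fab linear0.
have [p fp] := eP (f r0 (point_class r0 true)).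
have [q fq] := eP (f r0 (point_class r0 false)).
(* With [p] and [q] the coordinates of the two images on the line, [q] times the first class minus
   [p] times the second is sent to 0. So both coordinates vanish, and the first class itself is
   killed. *)
have [q0 p0] : q = 0 /\ - p = 0.
  apply: ker; rewrite linearD !linearZ [f r0 _]fp [f r0 _]fq.
  by rewrite /= !scalerA mulNr mulrC scaleNr subrr.
have [/eqP] : 1 = 0 :> F /\ 0 = 0 :> F.
  apply: ker; rewrite scale0r addr0 scale1r [LHS]fp.
  by move/eqP: p0; rewrite oppr_eq0 => /eqP->; rewrite scale0r.
by rewrite oner_eq0.
Qed.

End TwoPoints.

Theorem theorem4p2 (R : realType) (F : fieldType) :
  (forall (X : choiceType) (d : X -> X -> R) (U : set (set X))
      (R1 R2 R3 : itv_bound R),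
    dissimilarity d -> triangle d -> \bigcup_(W in U) W = setT ->
    thresholds F d U R1 R2 R3 ->
    exists alpha : {nonneg R} -> {nonneg R},
      [/\ {homo alpha : r r' / r <= r'},
          forall r, (BRight r%:num <= R1)%O -> alpha r = r,
          forall r, (BRight r%:num <= R2)%O -> (alpha r)%:num <= 2 * r%:num,
          forall r, (BRight r%:num <= R3)%O -> (alpha r)%:num <= 3 * r%:num
        & forall k : nat,
          interleaved_on setT [set r : {nonneg R} | (BRight r%:num <= R3)%O]
            id alpha (cover_rips_homology d F U k) (rips_homology d F k)]) /\
  (exists (X : choiceType) (d : X -> X -> R) (U : set (set X))
      (R1 R2 R3 : itv_bound R) (k : nat),
    [/\ dissimilarity d, triangle d, \bigcup_(W in U) W = setT &
        thresholds F d U R1 R2 R3] /\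
    (R3 < +oo)%O /\
    forall r0 : {nonneg R}, (R3 < BRight r0%:num)%O ->
    forall alpha : {nonneg R} -> {nonneg R},
      {homo alpha : r r' / r <= r'} ->
      ~ interleaved_on setT [set r : {nonneg R} | r <= r0]
          id alpha (cover_rips_homology d F U k) (rips_homology d F k)).
Proof.
split=> [X d U R1 R2 R3 dissim dtri _ thr|].
  exists (radius_nng R1 R2); split.
  - move=> r r' rr'; change (radius R1 R2 r%:num <= radius R1 R2 r'%:num).
    exact: radius_mono.
  - by move=> r rR1; apply: val_inj; rewrite /= /radius rR1.
  - move=> r rR2; rewrite /= /radius rR2; case: ifP => // _.
    by rewrite ler_peMl // ler1n.
  - move=> r _; rewrite /= /radius; case: ifP => _; last case: ifP => _.
    + by rewrite ler_peMl // ler1n.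
    + by rewrite ler_wpM2r // ler_nat.
    + by [].
  - exact: rips_interleaving_exists thr.
exists bool, (@two_dist R), singletons, (BLeft 1), (BLeft 1), (BLeft 1), 0%N.
split; [split|split].
- exact: two_dist_dissimilarity.
- exact: two_dist_triangle.
- by apply/seteqP; split=> // x _; exists [set x] => //; exists x.
- exact: thresholds_two.
- by [].
- by move=> r0; rewrite bnd_simp => r1 alpha _; exact: two_not_interleaved.
Qed.
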